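(* Assume that for $\xi\in P$ one of the following holds: (i) the size of the nilpotent Jordan block of $\xi$ is at least three; (ii) $n\ge3$, and the size of the nilpotent Jordan block of $\xi$ is two; (iii) $\xi$ has at least three (different) non-zero eigenvalues. Then $\mathcal{F}_q(O_\xi^{\mathrm{cl}})=\mathcal{L}_q(M)/\mathcal{I}_\xi$ is not an embedded quantum homogeneous space.
   Context: Fix a positive integer $n$; $G=SL(n,\mathbb{C})$ acts from the right on $M=M(n,\mathbb{C})$ by $(\xi,g)\mapsto g^{-1}\xi g$; $O_\xi$ is the $G$-orbit of $\xi$ and $O_\xi^{\mathrm{cl}}$ its Zariski closure. $P\subset M$ is the set of matrices all of whose non-zero eigenvalues have multiplicity one and which have only one nilpotent Jordan block (of size $r\in\{0,1,\dots,n\}$). $\mathcal{F}(V)$ is the coordinate ring of an affine variety $V$. $\mathbb{K}=\mathbb{C}[q]_{(q-1)}\subset\mathbb{C}(q)$ is the ring of rational functions in the indeterminate $q$ with no pole at $1$. Repeated indices are summed. R-matrix: $R\in\mathrm{End}_{\mathbb K}(\mathbb{K}^n\otimes\mathbb{K}^n)$, $R(e_j\otimes e_t)=R^{is}_{jt}e_i\otimes e_s$, where $R^{is}_{jt}=q$ if $i=j=s=t$; $=1$ if $i=j$, $s=t$, $i\ne s$; $=q-q^{-1}$ if $i>j$, $i=t$, $j=s$; $=0$ otherwise. $\widehat R=\phi\circ R$ with $\phi(a\otimes b)=b\otimes a$. $\mathcal{F}_q(M)$ is the $\mathbb{K}$-algebra generated by the entries of $X=[x^i_j]_{i,j=1}^n$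 subject to $\widehat R(X\otimes I)(I\otimes X)=(X\otimes I)(I\otimes X)\widehat R$, a bialgebra with $\Delta(x^i_j)=x^i_s\otimes x^s_j$, $\varepsilon(x^i_j)=\delta^i_j$. $\det_q=\sum_{\sigma\in \mathrm{Sym}_n}(-q)^{\mathrm{length}(\sigma)}x^1_{\sigma(1)}\cdots x^n_{\sigma(n)}$. $\mathcal{F}_q(G)=\mathcal{F}_q(M)/(\det_q-1)$ is a Hopf algebra with antipode $S$; $t^i_j$ is the image of $x^i_j$. $\mathcal{L}_q(M)$ is the $\mathbb{K}$-algebra generated by the entries of $L=[l^i_j]_{i,j=1}^n$ subject to $\widehat R(I\otimes L)\widehat R(I\otimes L)=(I\otimes L)\widehat R(I\otimes L)\widehat R$. It is a right $\mathcal{F}_q(G)$-comodule algebra via the algebra homomorphism $\beta(l^i_j)=l^a_b\otimes S(t^i_a)t^b_j$. The $\mathbb{K}$-module isomorphism $\Phi:\mathcal{F}_q(M)\to\mathcal{L}_q(M)$ is the $\mathbb{K}$-linear (not multiplicative) map with $\Phi(1)=1$ and, for all $d\ge1$, $\Phi(X_1X_2\cdots X_d)=L_{(d)}L_{(d-1)}\cdots L_{(1)}$ entrywise, as matrices acting on $(\mathbb{K}^n)^{\otimes d}$; here $X_k$ is $X$ in the $k$-th tensor factor, $\widehat R_k$ is $\widehat R$ in factors $k,k+1$, $L_{(d)}$ is $L$ in the $d$-th factor, and $L_{(k)}=\widehat R_kL_{(k+1)}\widehat R_k^{-1}$ for $k=d-1,\dots,1$. For $d=1,\dots,n$, $\tau_d=\sum_{I}q^{d(n+1)-2\sum_{i\in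 I}i}\det_q(I,I)\in\mathcal{F}_q(M)$, summing over $d$-element subsets $I=\{i_1<\dots<i_d\}$ of $\{1,\dots,n\}$, where $\det_q(I,I)=\sum_{\sigma\in\mathrm{Sym}_d}(-q)^{\mathrm{length}(\sigma)}x^{i_1}_{i_{\sigma(1)}}\cdots x^{i_d}_{i_{\sigma(d)}}$. For $\xi\in P$ choose a Jordan normal form $J(\xi)=\mathrm{diag}(J_r,\lambda_1,\dots,\lambda_{n-r})$ in the $G$-orbit of $\xi$, where $J_r$ is the $r\times r$ nilpotent upper triangular Jordan block and $\lambda_1,\dots,\lambda_{n-r}$ are the pairwise different non-zero eigenvalues of $\xi$. The map $X\mapsto J(\xi)$ extends to a $\mathbb{K}$-algebra homomorphism $\mathrm{ev}_\xi:\mathcal{F}_q(M)\to\mathbb{K}$, and $\tau_d(\xi)=\mathrm{ev}_\xi(\tau_d)$. $\mathcal{I}_\xi$ is the ideal of $\mathcal{L}_q(M)$ generated by $\Phi(\tau_d)-\tau_d(\xi)$, $d=1,\dots,n$; it is a subcomodule, and $\mathcal{F}_q(O_\xi^{\mathrm{cl}})=\mathcal{L}_q(M)/\mathcal{I}_\xi$ with the coaction induced by $\beta$. A quantum deformation of an affine $G$-variety $V$ is a right $\mathcal{F}_q(G)$-comodule algebra $(\mathcal{F}_q(V),\varphi)$ such that: (i) $\mathcal{F}_q(V)$ is a free $\mathbb{K}$-module; (ii) $\mathcal{F}_q(V)/(q-1)\mathcal{F}_q(V)\cong\mathcal{F}(V)$; (iii) the square formed by $\varphi$, the coaction $\mathcal{F}(V)\to\mathcal{F}(V)\otimes_{\mathbb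 C}\mathcal{F}(G)$, and the natural surjections with kernel generated by $q-1$, commutes. It is a quantum homogeneous $G$-space if $V$ contains a dense $G$-orbit. (For $\xi\in P$, $\mathcal{F}_q(O_\xi^{\mathrm{cl}})$ is a quantum homogeneous $G$-space, being a quantum deformation of $O_\xi^{\mathrm{cl}}$.) A quantum homogeneous $G$-space $(\mathcal{F}_q(V),\varphi)$ is embedded if there is a right coideal subalgebra $\mathcal{A}$ of $\mathcal{F}_q(G)$ (a subalgebra with $\Delta(\mathcal A)\subseteq\mathcal{A}\otimes\mathcal{F}_q(G)$) such that (i) $\mathcal{F}_q(V)$ is isomorphic to $\mathcal{A}$ as an $\mathcal{F}_q(G)$-comodule algebra, where the coaction on $\mathcal{A}$ is the restriction of $\Delta$; and (ii) the quotient $\mathbb{K}$-module $\mathcal{F}_q(G)/\mathcal{A}$ is torsion free. *)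

(* Defs.v *)
From HB Require Import structures.
From mathcomp Require Import all_boot all_order perm all_algebra.
From mathcomp Require Import finmap boolp classical_sets reals.
From mathcomp Require Import complex monalg.

Set Implicit Arguments.
Unset Strict Implicit.
Unset Printing Implicit Defensive.

Import GRing.Theory.
Local Open Scope ring_scope.
Local Open Scope classical_set_scope.
Local Open Scope quotient_scope.

(* MathComp's algType excludes the zero ring, but a quotient or a tensor      *)
(* product of algebras may vanish; hence K-algebras are given here as         *)
(* possibly zero rings with a central structure morphism K -> A, and the      *)
(* scalar multiplication by k is the product with algmap k.                   *)
HB.mixin Record isPzAlgebra (K : pzRingType) A of GRing.PzRing A := {
  algmap : K -> A;
  algmap_zmod_morphism : zmod_morphism algmap;
  algmap_monoid_morphism : monoid_morphism algmap;
  algmapC : forall k x, algmap k * x = x * algmap k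
}.
#[short(type="pzAlgType")]
HB.structure Definition PzAlgebra (K : pzRingType) :=
  {A of GRing.PzRing A & isPzAlgebra K A}.

HB.instance Definition _ (K : pzRingType) (A : pzAlgType K) :=
  GRing.isZmodMorphism.Build K A (@algmap K A) algmap_zmod_morphism.
HB.instance Definition _ (K : pzRingType) (A : pzAlgType K) :=
  GRing.isMonoidMorphism.Build K A (@algmap K A) algmap_monoid_morphism.

HB.mixin Record isAlgMorphism (K : pzRingType) (A B : pzAlgType K)
    (f : A -> B) := { algmorph : forall k : K, f (algmap k) = algmap k }.
HB.structure Definition AlgMorphism (K : pzRingType) (A B : pzAlgType K) :=
  {f of @GRing.RMorphism A B f & isAlgMorphism K A B f}.
Notation "{ 'algmorph' A -> B }" := (@AlgMorphism.type _ A%type B%type)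
  (at level 0, A at level 98, B at level 99,
   format "{ 'algmorph'  A  ->  B }") : type_scope.

Definition modof (K : pzRingType) (A : pzAlgType K) : Type := A.

Section ModOf.
Variables (K : pzRingType) (A : pzAlgType K).
HB.instance Definition _ := GRing.Zmodule.on (modof A).
Let scale (k : K) (x : modof A) : modof A := algmap k * (x : A).
Fact modof_scalerA a b v : scale a (scale b v) = scale (a * b) v.
Proof. by rewrite /scale rmorphM mulrA. Qed.
Fact modof_scale1r : left_id 1 scale.
Proof. by move=> v; rewrite /scale rmorph1 mul1r. Qed.
Fact modof_scalerDr : right_distributive scale +%R.
Proof. by move=> k u v; rewrite /scale mulrDr. Qed.
Fact modof_scalerDl v : {morph scale^~ v : a b / a + b}.
Proof. by move=> a b; rewrite /scale rmorphD mulrDl. Qed.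
HB.instance Definition _ := GRing.Zmodule_isLmodule.Build K (modof A)
  modof_scalerA modof_scale1r modof_scalerDr modof_scalerDl.
End ModOf.

(* Operations on quotients are sealed, so that no conversion test unfolds     *)
(* them down to choices of representatives.                                   *)
Fact quot_key : unit. Proof. by []. Qed.

Section ZQuot.
Variables (V : zmodType) (S : zmodClosed V).

Definition zquot : Type := Quotient.quot S.
HB.instance Definition _ := Choice.on zquot.

Definition zpi : V -> zquot :=
  locked_with quot_key (fun v => \pi_(Quotient.quot S) v).
Definition zrepr : zquot -> V :=
  locked_with quot_key (fun x => repr (x : Quotient.quot S)).

Lemma zreprK : cancel zrepr zpi.
Proof. by move=> x; rewrite /zpi /zrepr !locked_withE reprK. Qed.

Lemma zpi_eq u v : zpi u = zpi v <-> u - v \in S.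
Proof.
rewrite /zpi locked_withE.
by split=> [/eqP|uv]; [|apply/eqP]; rewrite piE.
Qed.

Let zero : zquot := zpi 0.
Definition zquot_opp : zquot -> zquot :=
  locked_with quot_key (fun x => zpi (- zrepr x)).
Definition zquot_add : zquot -> zquot -> zquot :=
  locked_with quot_key (fun x y => zpi (zrepr x + zrepr y)).

Let zpiD u v : zpi (u + v) = zquot_add (zpi u) (zpi v).
Proof.
rewrite /zquot_add locked_withE; apply/zpi_eq.
by rewrite opprD addrACA rpredD //; apply/zpi_eq; rewrite zreprK.
Qed.
Let zpiN u : zpi (- u) = zquot_opp (zpi u).
Proof.
rewrite /zquot_opp locked_withE; apply/zpi_eq.
by rewrite -opprD rpredN; apply/zpi_eq; rewrite zreprK.
Qed.

Fact zquot_addA : associative zquot_add.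
Proof.
by move=> x y z; rewrite -[x]zreprK -[y]zreprK -[z]zreprK -!zpiD addrA.
Qed.
Fact zquot_addC : commutative zquot_add.
Proof. by move=> x y; rewrite -[x]zreprK -[y]zreprK -!zpiD addrC. Qed.
Fact zquot_add0 : left_id zero zquot_add.
Proof. by move=> x; rewrite -[x]zreprK -!zpiD add0r. Qed.
Fact zquot_addN : left_inverse zero zquot_opp zquot_add.
Proof. by move=> x; rewrite -[x]zreprK -zpiN -!zpiD addNr. Qed.
HB.instance Definition _ := GRing.isZmodule.Build zquot
  zquot_addA zquot_addC zquot_add0 zquot_addN.

Fact zpi_zmod_morphism : zmod_morphism zpi.
Proof. by move=> u v; rewrite zpiD zpiN. Qed.
HB.instance Definition _ := GRing.isZmodMorphism.Build V zquot zpi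
  zpi_zmod_morphism.

End ZQuot.

Section Span.
Variables (K : comNzRingType) (V : lmodType K).

Definition submodule (P : set V) : Prop :=
  [/\ P 0, forall u v, P u -> P v -> P (u + v)
         & forall k v, P v -> P (k *: v)].

Definition lspan (G : set V) : {pred V} :=
  fun v => `[< forall P : set V, submodule P -> G `<=` P -> P v >].

Variable G : set V.

Lemma lspanP v :
  reflect (forall P : set V, submodule P -> G `<=` P -> P v) (v \in lspan G).
Proof. exact: asboolP. Qed.

Lemma lspan_gen v : G v -> v \in lspan G.
Proof. by move=> Gv; apply/lspanP => P _; apply. Qed.

Lemma lspanZ k v : v \in lspan G -> k *: v \in lspan G.
Proof.
move=> /lspanP sv; apply/lspanP => P sP GP.
by case: (sP) => _ _; apply; apply: sv.
Qed.

Fact lspan_zmod_closed : zmod_closed (lspan G).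
Proof.
split; first by apply/lspanP => P [].
move=> u v su sv; have /lspanP {}sv : - v \in lspan G.
  by rewrite -scaleN1r lspanZ.
move/lspanP: su => su; apply/lspanP => P sP GP.
by case: (sP) => _ + _; apply; [apply: su|apply: sv].
Qed.

HB.instance Definition _ := GRing.isZmodClosed.Build V (lspan G)
  lspan_zmod_closed.

Definition quotmod : Type := zquot (lspan G).
HB.instance Definition _ := GRing.Zmodule.on quotmod.

Definition qmod : V -> quotmod := zpi (lspan G).
HB.instance Definition _ := GRing.Additive.on qmod.
Definition mrepr : quotmod -> V := @zrepr _ (lspan G).

Lemma mreprK : cancel mrepr qmod. Proof. exact: zreprK. Qed.

Lemma qmod_eq u v : qmod u = qmod v <-> u - v \in lspan G.
Proof. exact: zpi_eq. Qed.

Definition qscale : K -> quotmod -> quotmod :=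
  locked_with quot_key (fun k x => qmod (k *: mrepr x)).

Lemma qmodZ k v : qmod (k *: v) = qscale k (qmod v).
Proof.
rewrite /qscale locked_withE; apply/qmod_eq.
rewrite -scalerBr lspanZ //; apply/qmod_eq.
by rewrite mreprK.
Qed.

Fact qscalerA a b v : qscale a (qscale b v) = qscale (a * b) v.
Proof. by rewrite -[v]mreprK -!qmodZ scalerA. Qed.
Fact qscale1r : left_id 1 qscale.
Proof. by move=> v; rewrite -[v]mreprK -!qmodZ scale1r. Qed.
Fact qscalerDr : right_distributive qscale +%R.
Proof.
by move=> a u v; rewrite -[u]mreprK -[v]mreprK -raddfD -!qmodZ scalerDr raddfD.
Qed.
Fact qscalerDl v : {morph qscale^~ v : a b / a + b}.
Proof. by move=> a b; rewrite -[v]mreprK -!qmodZ scalerDl raddfD. Qed.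
HB.instance Definition _ := GRing.Zmodule_isLmodule.Build K quotmod
  qscalerA qscale1r qscalerDr qscalerDl.

Fact qmod_is_scalable : scalable qmod.
Proof. by move=> k v; rewrite qmodZ. Qed.
HB.instance Definition _ := GRing.isScalable.Build K V quotmod *:%R qmod
  qmod_is_scalable.

End Span.

Section QuotAlgebra.
Variables (K : comNzRingType) (A : pzAlgType K) (rels : set A).

Definition two_sided_ideal (I : set A) : Prop :=
  [/\ I 0, forall x y, I x -> I y -> I (x - y)
         & forall a x b, I x -> I (a * x * b)].

Definition ideal_gen : {pred A} :=
  fun x => `[< forall I : set A, two_sided_ideal I -> rels `<=` I -> I x >].

Lemma ideal_genP x :
  reflect (forall I : set A, two_sided_ideal I -> rels `<=` I -> I x)
          (x \in ideal_gen).
Proof. exact: asboolP. Qed.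

Lemma ideal_gen_rel x : rels x -> x \in ideal_gen.
Proof. by move=> rx; apply/ideal_genP => I _; apply. Qed.

Lemma ideal_genM a x b : x \in ideal_gen -> a * x * b \in ideal_gen.
Proof.
move=> /ideal_genP Ix; apply/ideal_genP => I idI rI.
by case: (idI) => _ _; apply; apply: Ix.
Qed.

Lemma ideal_genMl a x : x \in ideal_gen -> a * x \in ideal_gen.
Proof. by move=> /(ideal_genM a 1); rewrite mulr1. Qed.

Lemma ideal_genMr b x : x \in ideal_gen -> x * b \in ideal_gen.
Proof. by move=> /(ideal_genM 1 b); rewrite mul1r. Qed.

Fact ideal_gen_zmod_closed : zmod_closed ideal_gen.
Proof.
split; first by apply/ideal_genP => I [].
move=> x y /ideal_genP Ix /ideal_genP Iy; apply/ideal_genP => I idI rI.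
by case: (idI) => _ + _; apply; [apply: Ix|apply: Iy].
Qed.
HB.instance Definition _ := GRing.isZmodClosed.Build A ideal_gen
  ideal_gen_zmod_closed.

Definition quotalg : Type := zquot ideal_gen.
HB.instance Definition _ := GRing.Zmodule.on quotalg.

Definition qproj : A -> quotalg := zpi ideal_gen.
HB.instance Definition _ := GRing.Additive.on qproj.
Let qrepr : quotalg -> A := @zrepr _ ideal_gen.

Lemma qreprK : cancel qrepr qproj. Proof. exact: zreprK. Qed.

Lemma qproj_eq x y : qproj x = qproj y <-> x - y \in ideal_gen.
Proof. exact: zpi_eq. Qed.

Lemma qproj_surj (x : quotalg) : exists y, x = qproj y.
Proof. by exists (qrepr x); rewrite qreprK. Qed.

Let qone : quotalg := qproj 1.
Definition qmul : quotalg -> quotalg -> quotalg :=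
  locked_with quot_key (fun x y => qproj (qrepr x * qrepr y)).

Let qmulE x y : qproj (x * y) = qmul (qproj x) (qproj y).
Proof.
rewrite /qmul locked_withE; apply/qproj_eq; set x' := qrepr _; set y' := qrepr _.
rewrite -(subrK (x' * y) (x * y)) -mulrBl -addrA -mulrBr rpredD //.
- by apply: ideal_genMr; apply/qproj_eq; rewrite qreprK.
- by apply: ideal_genMl; apply/qproj_eq; rewrite qreprK.
Qed.

Fact qmulA : associative qmul.
Proof.
by move=> x y z; rewrite -[x]qreprK -[y]qreprK -[z]qreprK -!qmulE mulrA.
Qed.
Fact qmul1r : left_id qone qmul.
Proof. by move=> x; rewrite -[x]qreprK -!qmulE mul1r. Qed.
Fact qmulr1 : right_id qone qmul.
Proof. by move=> x; rewrite -[x]qreprK -!qmulE mulr1. Qed.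
Fact qmulDl : left_distributive qmul +%R.
Proof.
move=> x y z; rewrite -[x]qreprK -[y]qreprK -[z]qreprK.
by rewrite -raddfD -!qmulE mulrDl raddfD.
Qed.
Fact qmulDr : right_distributive qmul +%R.
Proof.
move=> x y z; rewrite -[x]qreprK -[y]qreprK -[z]qreprK.
by rewrite -raddfD -!qmulE mulrDr raddfD.
Qed.
HB.instance Definition _ := GRing.Zmodule_isPzRing.Build quotalg
  qmulA qmul1r qmulr1 qmulDl qmulDr.

Fact qproj_monoid_morphism : monoid_morphism qproj.
Proof. by split=> // x y; rewrite qmulE. Qed.
HB.instance Definition _ := GRing.isMonoidMorphism.Build A quotalg qproj
  qproj_monoid_morphism.

Definition qalgmap (k : K) : quotalg := qproj (algmap k).
Fact qalgmap_zmod_morphism : zmod_morphism qalgmap.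
Proof. by move=> a b; rewrite /qalgmap !raddfB. Qed.
Fact qalgmap_monoid_morphism : monoid_morphism qalgmap.
Proof. by split=> [|a b]; rewrite /qalgmap ?rmorph1 // !rmorphM. Qed.
Fact qalgmapC k x : qalgmap k * x = x * qalgmap k.
Proof. by rewrite -[x]qreprK -!rmorphM algmapC. Qed.
HB.instance Definition _ := isPzAlgebra.Build K quotalg
  qalgmap_zmod_morphism qalgmap_monoid_morphism qalgmapC.

Fact qproj_algmorph k : qproj (algmap k) = algmap k.
Proof. by []. Qed.
HB.instance Definition _ := isAlgMorphism.Build K A quotalg qproj
  qproj_algmorph.

End QuotAlgebra.

Section Tensor.
Variable K : comNzRingType.
Implicit Types A B : pzAlgType K.

Local Notation U := (fun p => mkmalgU p (1 : K)).

(* The bilinearity relations in the free K-module on A * B. *)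
Definition tens_rels A B : set {malg K[(A * B)%type]} :=
  fun x =>
  [\/ exists a a' b, x = U (a + a', b) - U (a, b) - U (a', b),
      exists a b b', x = U (a, b + b') - U (a, b) - U (a, b'),
      exists k a b, x = U (algmap k * a, b) - k *: U (a, b)
    | exists k a b, x = U (a, algmap k * b) - k *: U (a, b)].

Definition tens A B : Type := quotmod (@tens_rels A B).
HB.instance Definition _ A B := GRing.Lmodule.on (tens A B).

Definition ptens A B (a : A) (b : B) : tens A B :=
  qmod (@tens_rels A B) (U (a, b)).

Local Notation "a ⊗ b" := (ptens a b) (at level 40).

Section Bilinear.
Variables A B : pzAlgType K.

Lemma ptensDl (a a' : A) (b : B) : (a + a') ⊗ b = a ⊗ b + a' ⊗ b.
Proof.
rewrite -raddfD; apply/qmod_eq/lspan_gen; constructor 1; exists a, a', b.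
by rewrite opprD addrA.
Qed.

Lemma ptensDr (a : A) (b b' : B) : a ⊗ (b + b') = a ⊗ b + a ⊗ b'.
Proof.
rewrite -raddfD; apply/qmod_eq/lspan_gen; constructor 2; exists a, b, b'.
by rewrite opprD addrA.
Qed.

Lemma ptensZl k (a : A) (b : B) : (algmap k * a) ⊗ b = k *: (a ⊗ b).
Proof.
by rewrite -linearZ; apply/qmod_eq/lspan_gen; constructor 3; exists k, a, b.
Qed.

Lemma ptensZr k (a : A) (b : B) : a ⊗ (algmap k * b) = k *: (a ⊗ b).
Proof.
by rewrite -linearZ; apply/qmod_eq/lspan_gen; constructor 4; exists k, a, b.
Qed.

Lemma malg_ind (P : {malg K[(A * B)%type]} -> Prop) :
  P 0 -> (forall u v, P u -> P v -> P (u + v)) ->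
  (forall k p, P (k *: U p)) -> forall u, P u.
Proof.
move=> P0 PD PU u; rewrite [u]monalgE; elim/big_ind: _ => // p _.
suff -> : mkmalgU p u@_p = u@_p *: U p by [].
by apply/malgP=> x; rewrite mcoeffZ !mcoeffU mulrnAr mulr1.
Qed.

Lemma tens_ind (P : tens A B -> Prop) :
  P 0 -> (forall u v, P u -> P v -> P (u + v)) ->
  (forall a b, P (a ⊗ b)) -> forall t, P t.
Proof.
move=> P0 PD PU t; rewrite -[t]mreprK; elim/malg_ind: (mrepr t) => [||k [a b]].
- by rewrite raddf0.
- by move=> u v Pu Pv; rewrite raddfD; apply: PD.
- by rewrite linearZ /= -/(ptens a b) -ptensZl.
Qed.

End Bilinear.

Section Lift.
Variables (A B : pzAlgType K) (M : lmodType K) (f : A -> B -> M).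

Definition bilinear_map : Prop :=
  [/\ forall a a' b, f (a + a') b = f a b + f a' b,
      forall a b b', f a (b + b') = f a b + f a b',
      forall k a b, f (algmap k * a) b = k *: f a b
    & forall k a b, f a (algmap k * b) = k *: f a b].

Let ext (u : {malg K[(A * B)%type]}) : M :=
  \sum_(p <- msupp u) u@_p *: f p.1 p.2.

(* For bilinear f, the linear map sending a ⊗ b to f a b. *)
Definition tens_lift : tens A B -> M :=
  locked_with quot_key (fun t => ext (mrepr t)).

Let extE (d : {fset (A * B)%type}) u : (msupp u `<=` d)%fset ->
  ext u = \sum_(p <- d) u@_p *: f p.1 p.2.
Proof.
move=> le; rewrite /ext [LHS](big_fset_incl _ le) => //= x xd /mcoeff_outdom ->.
by rewrite scale0r.
Qed.

Let extB u v : ext (u - v) = ext u - ext v.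
Proof.
pose d := (msupp u `|` msupp v)%fset.
rewrite !(@extE d) ?fsubsetUl ?fsubsetUr //; last exact: msuppB_le.
by rewrite -sumrB; apply: eq_bigr => p _; rewrite mcoeffB scalerBl.
Qed.

Let extD u v : ext (u + v) = ext u + ext v.
Proof.
have ext0 : ext 0 = 0 by rewrite -(subrr 0) extB subrr.
by rewrite -[v]opprK -[- v]add0r !extB ext0 !sub0r !opprK.
Qed.

Let extZ k u : ext (k *: u) = k *: ext u.
Proof.
rewrite (extE (msuppZ_le _ _)) /ext scaler_sumr.
by apply: eq_bigr => p _; rewrite mcoeffZ scalerA.
Qed.

Let extU p : ext (U p) = f p.1 p.2.
Proof. by rewrite (extE msuppU_le) big_seq_fset1 mcoeffUU scale1r. Qed.

Hypothesis fb : bilinear_map.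

Let ext_rel u : u \in lspan (@tens_rels A B) -> ext u = 0.
Proof.
case: fb => fDl fDr fZl fZr.
move=> /lspanP/(_ (fun u => ext u = 0)); apply; first split.
- by rewrite -(subrr 0) extB subrr.
- move=> v w v0 w0; have ext0 : ext 0 = 0 by rewrite -(subrr 0) extB subrr.
  by rewrite -[w]opprK -[- w]add0r !extB v0 w0 ext0 !subr0.
- by move=> k v v0; rewrite extZ v0 scaler0.
move=> v [[a [a' [b ->]]]|[a [b [b' ->]]]|[k [a [b ->]]]|[k [a [b ->]]]] /=.
- by rewrite !extB !extU /= fDl addrAC addrK subrr.
- by rewrite !extB !extU /= fDr addrAC addrK subrr.
- by rewrite extB extZ !extU /= fZl subrr.
- by rewrite extB extZ !extU /= fZr subrr.
Qed.

Let tens_lift_qmod u : tens_lift (qmod (@tens_rels A B) u) = ext u.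
Proof.
apply/eqP; rewrite -subr_eq0 /tens_lift locked_withE -extB; apply/eqP/ext_rel.
by apply/qmod_eq; rewrite mreprK.
Qed.

Lemma tens_liftE a b : tens_lift (a ⊗ b) = f a b.
Proof. by rewrite tens_lift_qmod extU. Qed.

Lemma tens_lift_linear : linear tens_lift.
Proof.
move=> k t t'; rewrite -[t]mreprK -[t']mreprK -linearP !tens_lift_qmod.
by rewrite extD extZ.
Qed.

End Lift.

Section Ring.
Variables A B : pzAlgType K.

(* (a ⊗ b) (a' ⊗ b') = (a a') ⊗ (b b') *)
Definition tens_mul : tens A B -> tens A B -> tens A B :=
  locked_with quot_key (fun s t =>
    tens_lift (fun a b => tens_lift (fun a' b' => (a * a') ⊗ (b * b')) t) s).

Let inner_bil (a : A) (b : B) :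
  bilinear_map (fun a' b' => (a * a') ⊗ (b * b')).
Proof.
split=> [a1 a2 b1|a1 b1 b2|k a1 b1|k a1 b1].
- by rewrite mulrDr ptensDl.
- by rewrite mulrDr ptensDr.
- by rewrite mulrA -algmapC -mulrA ptensZl.
- by rewrite mulrA -algmapC -mulrA ptensZr.
Qed.

Let outer_bil (t : tens A B) : bilinear_map
  (fun a b => tens_lift (fun a' b' => (a * a') ⊗ (b * b')) t).
Proof.
have lin (a : A) (b : B) := tens_lift_linear (inner_bil a b).
have linD (a : A) (b : B) u v : tens_lift (fun a' b' => (a * a') ⊗ (b * b')) (u + v) =
    tens_lift (fun a' b' => (a * a') ⊗ (b * b')) u +
    tens_lift (fun a' b' => (a * a') ⊗ (b * b')) v.
  by have := lin a b 1 u v; rewrite !scale1r.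
have lin0 (a : A) (b : B) : tens_lift (fun a' b' => (a * a') ⊗ (b * b')) 0 = 0.
  by apply: (addIr (tens_lift (fun a' b' => (a * a') ⊗ (b * b')) 0));
     rewrite -linD !add0r.
split=> [a1 a2 b1|a1 b1 b2|k a1 b1|k a1 b1]; elim/tens_ind: t.
- by rewrite !lin0 addr0.
- by move=> u v Hu Hv; rewrite !linD Hu Hv addrACA.
- by move=> a b; rewrite !(tens_liftE (inner_bil _ _)) mulrDl ptensDl.
- by rewrite !lin0 addr0.
- by move=> u v Hu Hv; rewrite !linD Hu Hv addrACA.
- by move=> a b; rewrite !(tens_liftE (inner_bil _ _)) mulrDl ptensDr.
- by rewrite !lin0 scaler0.
- by move=> u v Hu Hv; rewrite !linD Hu Hv scalerDr.
- by move=> a b; rewrite !(tens_liftE (inner_bil _ _)) -mulrA ptensZl.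
- by rewrite !lin0 scaler0.
- by move=> u v Hu Hv; rewrite !linD Hu Hv scalerDr.
- by move=> a b; rewrite !(tens_liftE (inner_bil _ _)) -mulrA ptensZr.
Qed.

Lemma tens_mulE a b a' b' :
  tens_mul (a ⊗ b) (a' ⊗ b') = (a * a') ⊗ (b * b').
Proof.
by rewrite /tens_mul locked_withE (tens_liftE (outer_bil _)) (tens_liftE (inner_bil _ _)).
Qed.

Fact tens_mulDl : left_distributive tens_mul +%R.
Proof.
move=> s s' t; rewrite /tens_mul locked_withE.
by have := tens_lift_linear (outer_bil t) 1 s s'; rewrite !scale1r.
Qed.

Fact tens_mulDr : right_distributive tens_mul +%R.
Proof.
have mul0 t : tens_mul 0 t = 0.
  by apply: (addIr (tens_mul 0 t)); rewrite -tens_mulDl !add0r.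
move=> s t t'; elim/tens_ind: s => [|u v Hu Hv|a b].
- by rewrite !mul0 addr0.
- by rewrite (tens_mulDl u v) Hu Hv (tens_mulDl u v t) (tens_mulDl u v t')
     addrACA.
- rewrite /tens_mul locked_withE !(tens_liftE (outer_bil _)).
  by have := tens_lift_linear (inner_bil a b) 1 t t'; rewrite !scale1r.
Qed.

Let tens_mul0 t : tens_mul 0 t = 0.
Proof. by apply: (addIr (tens_mul 0 t)); rewrite -tens_mulDl !add0r. Qed.
Let tens_mulr0 t : tens_mul t 0 = 0.
Proof. by apply: (addIr (tens_mul t 0)); rewrite -tens_mulDr !add0r. Qed.

Fact tens_mulA : associative tens_mul.
Proof.
move=> s t u; elim/tens_ind: s => [|x y Hx Hy|a b].
- by rewrite !tens_mul0.
- by rewrite !tens_mulDl Hx Hy.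
elim/tens_ind: t => [|x y Hx Hy|a' b'].
- by rewrite tens_mulr0 !tens_mul0 tens_mulr0.
- by rewrite tens_mulDr !tens_mulDl tens_mulDr Hx Hy.
elim/tens_ind: u => [|x y Hx Hy|a'' b''].
- by rewrite !tens_mulr0.
- by rewrite !tens_mulDr Hx Hy.
by rewrite !tens_mulE !mulrA.
Qed.

Fact tens_mul1r : left_id (1 ⊗ 1) tens_mul.
Proof.
move=> t; elim/tens_ind: t => [|x y Hx Hy|a b].
- by rewrite tens_mulr0.
- by rewrite tens_mulDr Hx Hy.
- by rewrite tens_mulE !mul1r.
Qed.

Fact tens_mulr1 : right_id (1 ⊗ 1) tens_mul.
Proof.
move=> t; elim/tens_ind: t => [|x y Hx Hy|a b].
- by rewrite tens_mul0.
- by rewrite tens_mulDl Hx Hy.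
- by rewrite tens_mulE !mulr1.
Qed.

HB.instance Definition _ := GRing.Zmodule_isPzRing.Build (tens A B)
  tens_mulA tens_mul1r tens_mulr1 tens_mulDl tens_mulDr.

Definition tens_algmap (k : K) : tens A B := algmap k ⊗ 1.

Fact tens_algmap_zmod_morphism : zmod_morphism tens_algmap.
Proof.
move=> a b; apply: (addIr (tens_algmap b)).
by rewrite subrK /tens_algmap -ptensDl -rmorphD subrK.
Qed.
Fact tens_algmap_monoid_morphism : monoid_morphism tens_algmap.
Proof.
split=> [|a b]; first by rewrite /tens_algmap rmorph1.
by rewrite [RHS]tens_mulE mulr1 -rmorphM.
Qed.
Fact tens_algmapC k t : tens_algmap k * t = t * tens_algmap k.
Proof.
elim/tens_ind: t => [|x y Hx Hy|a b].
- by rewrite mulr0 mul0r.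
- by rewrite mulrDr mulrDl Hx Hy.
- by rewrite [LHS]tens_mulE [RHS]tens_mulE algmapC mul1r mulr1.
Qed.
HB.instance Definition _ := isPzAlgebra.Build K (tens A B)
  tens_algmap_zmod_morphism tens_algmap_monoid_morphism tens_algmapC.

End Ring.

End Tensor.

Notation "a ⊗ b" := (ptens a b) (at level 40, left associativity).


Section FreeAlgebra.
Variables (K : comNzRingType) (I : choiceType).

(* The free K-algebra K<I>: the monoid algebra of the free monoid on I. *)
Definition freealg : Type := {malg K[{fmonom I}]}.
HB.instance Definition _ := GRing.Lalgebra.on freealg.

Definition fvar (i : I) : freealg := mkmalgU (fmu i) 1.

Let algmap (k : K) : freealg := malgC k.
Fact freealg_algmap_zmod_morphism : zmod_morphism algmap.
Proof. exact: raddfB. Qed.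
Fact freealg_algmap_monoid_morphism : monoid_morphism algmap.
Proof. by split=> [|a b]; rewrite /algmap ?rmorph1 // rmorphM. Qed.
Fact freealg_algmapC k (x : freealg) : algmap k * x = x * algmap k.
Proof.
rewrite /algmap mul_malgC malgM_def malgZ_def fgmulgU.
by apply: eq_bigr => m _; rewrite mulm1 mulrC.
Qed.
HB.instance Definition _ := isPzAlgebra.Build K freealg
  freealg_algmap_zmod_morphism freealg_algmap_monoid_morphism
  freealg_algmapC.

End FreeAlgebra.

Section LocalRing.
Variable F : fieldType.

Definition regular_at_1 : {pred {fraction {poly F}}} :=
  fun f => `[< exists a b : {poly F},
                 b.[1] != 0 /\ f = FracField.tofrac a / FracField.tofrac b >].

Fact regular_at_1_subring : subring_closed regular_at_1.
Proof.
have nz (b : {poly F}) : b.[1] != 0 -> FracField.tofrac b != 0.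
  by rewrite tofrac_eq0; apply: contraNneq => ->; rewrite horner0.
split=> [|f g|f g].
- apply/asboolP; exists 1, 1; rewrite hornerC oner_eq0; split=> //.
  by rewrite rmorph1 divr1.
- move=> /asboolP[a [b [b1 ->]]] /asboolP[c [d [d1 ->]]]; apply/asboolP.
  exists (a * d - c * b), (b * d); rewrite hornerM mulf_neq0 //; split=> //.
  by rewrite rmorphB !rmorphM -[in LHS]mulNr addf_div ?nz // mulNr.
- move=> /asboolP[a [b [b1 ->]]] /asboolP[c [d [d1 ->]]]; apply/asboolP.
  exists (a * c), (b * d); rewrite hornerM mulf_neq0 //; split=> //.
  by rewrite !rmorphM /= mulf_div.
Qed.
HB.instance Definition _ := GRing.isSubringClosed.Build {fraction {poly F}}
  regular_at_1 regular_at_1_subring.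

(* locK is F[q]_(q-1), the rational functions over F without pole at 1. *)
Record locK := LocK { locK_val : {fraction {poly F}};
                      locK_valP : locK_val \in regular_at_1 }.
HB.instance Definition _ := [isSub for locK_val].
HB.instance Definition _ := [Choice of locK by <:].
HB.instance Definition _ := [SubChoice_isSubComNzRing of locK by <:].

Let unit : {pred locK} :=
  fun x => (val x != 0) && ((val x)^-1 \in regular_at_1).
Let inv (x : locK) : locK := insubd x (val x)^-1.

Fact locK_mulVx : {in unit, left_inverse 1 inv *%R}.
Proof.
move=> x /andP[x0 xV]; apply: val_inj; rewrite /= val_insubd xV.
by rewrite mulVf.
Qed.
Fact locK_unitP x y : y * x = 1 -> unit x.
Proof.
move=> /(congr1 val)/= yx; have x0 : val x != 0.
  by apply: contra_eq_neq yx => ->; rewrite mulr0 eq_sym oner_eq0.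
by rewrite /unit x0 /= -[_^-1]mul1r -yx mulfK //; apply: locK_valP.
Qed.
Fact locK_invr_out : {in [predC unit], inv =1 id}.
Proof.
move=> x; rewrite inE /= => xU; apply: val_inj; rewrite /= val_insubd.
case: ifP => // xV; move: xU; rewrite -topredE /= /unit xV andbT negbK.
by move=> /eqP ->; rewrite invr0.
Qed.
HB.instance Definition _ := GRing.ComNzRing_hasMulInverse.Build locK
  locK_mulVx locK_unitP locK_invr_out.
Fact locK_integral (x y : locK) : x * y = 0 -> (x == 0) || (y == 0).
Proof. by move=> /(congr1 val)/eqP; rewrite /= mulf_eq0. Qed.
HB.instance Definition _ := GRing.ComUnitRing_isIntegral.Build locK
  locK_integral.

Fact locK_poly_subproof (p : {poly F}) :
  FracField.tofrac p \in regular_at_1.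
Proof.
apply/asboolP; exists p, 1; rewrite hornerC oner_eq0; split=> //.
by rewrite rmorph1 divr1.
Qed.
Definition locK_poly (p : {poly F}) : locK := LocK (locK_poly_subproof p).
Definition locK_const (c : F) : locK := locK_poly c%:P.
Definition locK_q : locK := locK_poly 'X.

Lemma locK_q_unit : locK_q \is a GRing.unit.
Proof.
apply/andP; split; first by rewrite /= tofrac_eq0 polyX_eq0.
apply/asboolP; exists 1, 'X; rewrite hornerX oner_eq0; split=> //.
by rewrite rmorph1 div1r.
Qed.

End LocalRing.

Section BaseAlgebra.
Variable K : comNzRingType.
Let algmap (k : K) : K^o := k.
Fact base_algmap_zmod_morphism : zmod_morphism algmap.
Proof. by []. Qed.
Fact base_algmap_monoid_morphism : monoid_morphism algmap.
Proof. by []. Qed.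
Fact base_algmapC k (x : K^o) : algmap k * x = x * algmap k.
Proof. exact: mulrC. Qed.
HB.instance Definition _ := isPzAlgebra.Build K K^o
  base_algmap_zmod_morphism base_algmap_monoid_morphism base_algmapC.
End BaseAlgebra.

Section HopfAlgebra.
Variable K : comNzRingType.

Definition tens_map (A A' B B' : pzAlgType K) (f : A -> A') (g : B -> B') :
  tens A B -> tens A' B' := tens_lift (fun a b => f a ⊗ g b).

Definition tens_assoc (A B C : pzAlgType K) :
  tens (tens A B) C -> tens A (tens B C) :=
  tens_lift (fun t c => tens_lift (fun a b => a ⊗ (b ⊗ c)) t).

Record hopf (H : pzAlgType K) := Hopf {
  hdelta : {algmorph H -> tens H H};
  heps : {algmorph H -> K^o};
  hanti : {linear modof H -> modof H};
  hdelta_coassoc : forall x,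
    tens_assoc (tens_map hdelta id (hdelta x)) = tens_map id hdelta (hdelta x);
  heps_counitl : forall x,
    tens_lift (M := modof H) (fun a b => algmap (heps a) * b) (hdelta x) = x;
  heps_counitr : forall x,
    tens_lift (M := modof H) (fun a b => a * algmap (heps b)) (hdelta x) = x;
  hantil : forall x,
    tens_lift (M := modof H) (fun a b => hanti a * b) (hdelta x)
    = algmap (heps x);
  hantir : forall x,
    tens_lift (M := modof H) (fun a b => a * hanti b) (hdelta x)
    = algmap (heps x)
}.

Record comodalg (H : pzAlgType K) (hH : hopf H) (B : pzAlgType K) := ComodAlg {
  coact :> {algmorph B -> tens B H};
  coact_coassoc : forall b,
    tens_assoc (tens_map coact id (coact b))
    = tens_map id (hdelta hH) (coact b);
  coact_counit : forall b,
    tens_lift (M := modof B) (fun b' h => b' * algmap (heps hH h)) (coact b) = b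
}.

Variables (H : pzAlgType K) (hH : hopf H).

Definition subalgebra (A : set H) : Prop :=
  [/\ submodule (A : set (modof H)), A 1
    & forall x y, A x -> A y -> A (x * y)].

(* A ⊗ H is read inside H ⊗ H as the span of the a ⊗ h with a in A. *)
Definition right_coideal_subalgebra (A : set H) : Prop :=
  subalgebra A /\
  forall a, A a ->
    hdelta hH a \in lspan [set t : tens H H | exists x h, A x /\ t = x ⊗ h].

Definition embedded (B : pzAlgType K) (phi : comodalg hH B) : Prop :=
  exists A : set H,
    [/\ right_coideal_subalgebra A,
        exists theta : {algmorph B -> H},
          [/\ injective theta, range theta = A
            & forall b, hdelta hH (theta b) = tens_map theta id (phi b)]
      & forall (k : K) h, k != 0 -> A (algmap k * h) -> A h].

End HopfAlgebra.

Section Quantum.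
Variables (K : comUnitRingType) (q : K) (n : nat).

(* coefficients of R: R (e_j ⊗ e_t) = \sum_(i, s) Rmat i s j t (e_i ⊗ e_s) *)
Definition Rmat (i s j t : 'I_n) : K :=
  if [&& i == j, j == s & s == t] then q
  else if (i == j) && (s == t) then 1
  else if [&& (j < i)%N, i == t & j == s] then q - q^-1
  else 0.

(* Rhat = flip \o R *)
Definition Rhat (i s j t : 'I_n) : K := Rmat s i j t.

(* Endomorphisms of (K^n)^{⊗d} with entries in an algebra are matrices        *)
(* indexed, through enum_val, by the basis vectors e_(u 0) ⊗ ... ⊗ e_(u d-1). *)
(* Tensor factors are numbered from 0.                                        *)
Section TensorPower.
Variable d : nat.
Local Notation idx := {ffun 'I_d -> 'I_n}.
Definition tmx (A : Type) := 'M[A]_#|{: idx}|.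

Definition tmx_of (A : Type) (f : idx -> idx -> A) : tmx A :=
  \matrix_(a, b) f (enum_val a) (enum_val b).

Definition in_factor (A : pzRingType) (X : 'M[A]_n) (k : 'I_d) : tmx A :=
  tmx_of (fun u v =>
    if [forall m, (m != k) ==> (u m == v m)] then X (u k) (v k) else 0).

Definition Rhat_in (k k' : 'I_d) : tmx K :=
  tmx_of (fun u v =>
    if [forall m, (m != k) && (m != k') ==> (u m == v m)]
    then Rhat (u k) (u k') (v k) (v k') else 0).

Definition scalar_tmx (A : pzAlgType K) (M : tmx K) : tmx A :=
  map_mx (@algmap K A) M.

End TensorPower.

Definition entries (A : Type) (N : nat) (M : 'M[A]_N) : set A :=
  [set x | exists a b, x = M a b].

Local Notation Free := (freealg K ('I_n * 'I_n)%type).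
Definition varmx : 'M[Free]_n := \matrix_(i, j) fvar K (i, j).

Definition FRT_rels : set Free :=
  let Rh := scalar_tmx Free (Rhat_in (ord0 : 'I_2) ord_max) in
  let X1 := in_factor varmx (ord0 : 'I_2) in
  let X2 := in_factor varmx (ord_max : 'I_2) in
  entries (Rh *m X1 *m X2 - X1 *m X2 *m Rh).

Definition FqM : Type := quotalg FRT_rels.
HB.instance Definition _ := PzAlgebra.on FqM.
Definition Xmx : 'M[FqM]_n := \matrix_(i, j) qproj FRT_rels (varmx i j).

Definition RE_rels : set Free :=
  let Rh := scalar_tmx Free (Rhat_in (ord0 : 'I_2) ord_max) in
  let L2 := in_factor varmx (ord_max : 'I_2) in
  entries (Rh *m L2 *m Rh *m L2 - L2 *m Rh *m L2 *m Rh).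

Definition LqM : Type := quotalg RE_rels.
HB.instance Definition _ := PzAlgebra.on LqM.
Definition Lmx : 'M[LqM]_n := \matrix_(i, j) qproj RE_rels (varmx i j).

Definition perm_length m (s : 'S_m) : nat :=
  #|[set p : 'I_m * 'I_m | (p.1 < p.2)%N && (s p.2 < s p.1)%N]|.

(* det_q(I, I); enum_val lists I in increasing order *)
Definition qminor (I : {set 'I_n}) : FqM :=
  \sum_(s : 'S_#|I|) algmap ((- q) ^+ perm_length s) *
    \prod_(a < #|I|) Xmx (enum_val a) (enum_val (s a)).

Definition qdet : FqM :=
  \sum_(s : 'S_n) algmap ((- q) ^+ perm_length s) * \prod_(i < n) Xmx i (s i).

Definition FqG : Type := quotalg [set qdet - 1].
HB.instance Definition _ := PzAlgebra.on FqG.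
Definition Tmx : 'M[FqG]_n := \matrix_(i, j) qproj [set qdet - 1] (Xmx i j).

(* The exponent uses the indices 1, ..., n. *)
Definition tau (d : nat) : FqM :=
  \sum_(I : {set 'I_n} | #|I| == d)
    algmap (q ^+ (d * n.+1)%N / q ^+ (2 * \sum_(i in I) i.+1)%N) * qminor I.

(* Lfactor d j is L_(d.+1 - j) acting on the (d.+1)-st tensor power. For q a  *)
(* unit, Rhat is invertible, as Rhat^2 = (q - q^-1) Rhat + 1.                 *)
Fixpoint Lfactor (d j : nat) : tmx d.+1 LqM :=
  if j is j'.+1 then
    let Rh := Rhat_in (inord (d - j)%N : 'I_d.+1) (inord (d - j')%N) in
    scalar_tmx LqM Rh *m Lfactor d j' *m scalar_tmx LqM (invmx Rh)
  else in_factor Lmx ord_max.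

Definition is_Phi (Phi : {linear modof FqM -> modof LqM}) : Prop :=
  Phi (1 : FqM) = (1 : LqM) /\
  forall d : nat,
    map_mx Phi (\big[mulmx/1%:M]_(k < d.+1) in_factor Xmx k)
    = \big[mulmx/1%:M]_(j < d.+1) Lfactor d j.

Definition is_qsl (HG : hopf FqG) : Prop :=
  (forall i j, hdelta HG (Tmx i j) = \sum_s Tmx i s ⊗ Tmx s j) /\
  (forall i j, heps HG (Tmx i j) = (i == j)%:R).

Definition is_adjoint_coaction (HG : hopf FqG) (beta : comodalg HG LqM) :=
  forall i j, beta (Lmx i j) =
    \sum_a \sum_b Lmx a b ⊗ ((hanti HG (Tmx i a) : FqG) * Tmx b j).

Definition Ixi_gens (Phi : FqM -> LqM) (ev : FqM -> K) : set LqM :=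
  [set y | exists d, (1 <= d <= n)%N /\
                     y = Phi (tau d) - algmap (ev (tau d))].

Definition FqO (Phi : FqM -> LqM) (ev : FqM -> K) : Type :=
  quotalg (Ixi_gens Phi ev).
HB.instance Definition _ Phi ev := PzAlgebra.on (FqO Phi ev).

Definition FqO_proj (Phi : FqM -> LqM) (ev : FqM -> K) : LqM -> FqO Phi ev :=
  @qproj K LqM (Ixi_gens Phi ev).

End Quantum.

Section Jordan.
Variables (F : fieldType) (n : nat).

(* diag(J_r, lam_1, ..., lam_(n-r)) *)
Definition jordan_mx (r : nat) (lam : seq F) : 'M[F]_n :=
  \matrix_(i, j)
    if (i < r)%N && (j < r)%N then (j == i.+1 :> nat)%:R
    else if i == j then lam`_(i - r)%N else 0.

Definition jordan_form (xi : 'M[F]_n) (r : nat) (lam : seq F) : Prop :=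
  [/\ (r <= n)%N, size lam = (n - r)%N, uniq lam, 0 \notin lam
    & exists g : 'M[F]_n, \det g = 1 /\ jordan_mx r lam = invmx g *m xi *m g].

Definition P_set : set 'M[F]_n :=
  [set xi | exists r lam, jordan_form xi r lam].

End Jordan.

(* Main.v *)
From HB Require Import structures.
Require Import Defs.
From mathcomp Require Import all_boot all_order perm all_algebra.
From mathcomp Require Import boolp classical_sets reals.
From mathcomp Require Import complex monalg ring zify.

Set Implicit Arguments.
Unset Strict Implicit.
Unset Printing Implicit Defensive.

(** An embedding [theta] of the coordinate algebra [FqO] into [FqG] turns the
    counit into a character of [FqO]; its value on L is a matrix Y over K that
    solves the reflection equation. Let y be Y at q = 1. Injectivity and
    torsion-freeness keep y from being more degenerate than the Jordan form J,
    while the reflection equation makes y degenerate.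

    - Every polynomial killing y kills J ([embedded_point]). The coaction
      gives theta(L) = S(T) Y T ([theta_Lmx]), hence theta(p(L)) = S(T) p(Y) T.
      If p(y) = 0, then p(Y) is divisible by q - 1, and torsion-freeness of the
      quotient with injectivity of [theta] bring the divisibility back to p(L)
      ([divisible_of_vanishing]). Specializing q to 1 and L to J, which is a
      character of [FqO] ([orbit_character]), yields p(J) = 0. That this
      specialization respects the relations Phi(tau_d) = tau_d(xi) amounts to
      Phi becoming multiplicative at q = 1, where Rhat is the flip and L_(k) is
      L in the k-th factor ([character_Phi_tau]).

    - The reflection equation for Y, divided by q - 1 and read at q = 1, says
      that the underlying quadratic Poisson bracket vanishes at y
      ([RE_first_order]). Such a matrix satisfies y^2 = l y, or
      y^3 = l y^2 + c y with c nonzero ([poisson_zero_relation]), with l the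
      first diagonal entry of y.

    - Hence J satisfies one of these two relations. A nilpotent block of size
      at least 2, in dimension at least 3, forbids both
      ([jordan_block_obstruction]), and so do three distinct nonzero eigenvalues
      ([three_eigenvalues_obstruction]), since a nonzero eigenvalue must equal l
      or be a root of a fixed quadratic polynomial. *)

Import GRing.Theory.
Local Open Scope ring_scope.

(** * Rational functions evaluated at q = 1 *)

Section ValueAtOne.
Variable F : fieldType.
Local Notation K := (locK F).
Local Notation frac := (@FracField.tofrac {poly F}).

Lemma tofrac_neq0 (b : {poly F}) : b.[1] != 0 -> frac b != 0.
Proof. by rewrite tofrac_eq0; apply: contraNneq => ->; rewrite horner0. Qed.

Lemma locK_repr (x : K) :
  exists ab : {poly F} * {poly F}, ab.2.[1] != 0 /\ val x = frac ab.1 / frac ab.2.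
Proof. by case: x => f /= /asboolP[a [b ab]]; exists (a, b). Qed.

(** The value does not depend on the chosen fraction ([at_oneE]). *)
Definition at_one (x : K) : F :=
  let ab := sval (cid (locK_repr x)) in ab.1.[1] / ab.2.[1].

Lemma at_oneE (x : K) (a b : {poly F}) :
  b.[1] != 0 -> val x = frac a / frac b -> at_one x = a.[1] / b.[1].
Proof.
rewrite /at_one; case: cid => -[c d] /= [d1 ->] b1 /eqP.
rewrite eqr_div ?tofrac_neq0 // -!rmorphM tofrac_eq => /eqP cb.
by apply/eqP; rewrite eqr_div // -!hornerM cb.
Qed.

Fact at_one_zmod_morphism : zmod_morphism at_one.
Proof.
move=> x y; have [[a b] /= [b1 xE]] := locK_repr x.
have [[c d] /= [d1 yE]] := locK_repr y.
rewrite (at_oneE b1 xE) (at_oneE d1 yE) (@at_oneE _ (a * d - c * b) (b * d)).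
- by rewrite !hornerE; field; apply/andP.
- by rewrite hornerM mulf_neq0.
by rewrite /= xE yE rmorphB !rmorphM -[in LHS]mulNr addf_div ?tofrac_neq0 // mulNr.
Qed.

Fact at_one_monoid_morphism : monoid_morphism at_one.
Proof.
split=> [|x y].
  by rewrite (@at_oneE _ 1 1) ?hornerC ?divr1 ?oner_eq0 //= rmorph1 divr1.
have [[a b] /= [b1 xE]] := locK_repr x.
have [[c d] /= [d1 yE]] := locK_repr y.
rewrite (at_oneE b1 xE) (at_oneE d1 yE) (@at_oneE _ (a * c) (b * d)).
- by rewrite !hornerM mulf_div.
- by rewrite hornerM mulf_neq0.
by rewrite /= xE yE !rmorphM /= mulf_div.
Qed.

HB.instance Definition _ :=
  GRing.isZmodMorphism.Build K F at_one at_one_zmod_morphism.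
HB.instance Definition _ :=
  GRing.isMonoidMorphism.Build K F at_one at_one_monoid_morphism.

Lemma at_one_poly (p : {poly F}) : at_one (locK_poly p) = p.[1].
Proof.
by rewrite (@at_oneE _ p 1) ?hornerC ?divr1 ?oner_eq0 //= rmorph1 divr1.
Qed.

Lemma at_one_const c : at_one (locK_const c) = c.
Proof. by rewrite at_one_poly hornerC. Qed.

Lemma at_one_q : at_one (locK_q F) = 1.
Proof. by rewrite at_one_poly hornerX. Qed.

Lemma locK_q_neq1 : locK_q F - 1 != 0.
Proof.
rewrite subr_eq0; apply/eqP => /(congr1 val) /=.
rewrite -tofrac1 => /eqP; rewrite tofrac_eq => /eqP/(congr1 (horner^~ 0)) /=.
by rewrite hornerX hornerC => /esym/eqP; rewrite oner_eq0.
Qed.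

(** K is local with maximal ideal (q - 1); the next two lemmas are how
    divisibility by q - 1 and invertibility are read off at q = 1. *)
Lemma at_one_eq0 (x : K) : at_one x = 0 -> exists y, x = (locK_q F - 1) * y.
Proof.
have [[a b] /= [b1 xE]] := locK_repr x.
rewrite (at_oneE b1 xE) => /eqP; rewrite mulf_eq0 invr_eq0 (negPf b1) orbF.
move=> /factor_theorem[c aE].
have yP : frac c / frac b \in @regular_at_1 F by apply/asboolP; exists c, b.
exists (LocK yP); apply: val_inj; rewrite /= xE aE rmorphM /= mulrAC mulrC.
by rewrite rmorphB /= polyC1 tofrac1.
Qed.

Lemma at_one_unit (x : K) : at_one x != 0 -> x \is a GRing.unit.
Proof.
have [[a b] /= [b1 xE]] := locK_repr x.
rewrite (at_oneE b1 xE) mulf_eq0 invr_eq0 negb_or => /andP[a1 _].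
apply/andP; split; rewrite /= xE; first by rewrite mulf_neq0 ?invr_eq0 ?tofrac_neq0.
by apply/asboolP; exists b, a; rewrite invf_div.
Qed.

End ValueAtOne.

(** * Universal properties of quotients and free algebras *)

Section Lift.
Variables (K : comNzRingType).

(** The target is an arbitrary ring, so that K-algebras can be mapped to F along
    evaluation at q = 1. *)
Lemma quotalg_lift (A : pzAlgType K) (rels : set A) (B : pzRingType)
    (g : {rmorphism A -> B}) : (forall x, rels x -> g x = 0) ->
  exists g' : {rmorphism quotalg rels -> B}, forall a, g' (qproj rels a) = g a.
Proof.
move=> grels.
have gker x : x \in ideal_gen rels -> g x = 0.
  move=> /ideal_genP/(_ (fun x => g x = 0)); apply=> //.
  split=> [|y z gy gz|a y b gy]; first exact: rmorph0.
    by rewrite rmorphB gy gz subr0.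
  by rewrite !rmorphM gy mulr0 mul0r.
pose f (x : quotalg rels) := g (sval (cid (qproj_surj x))).
have fE a : f (qproj rels a) = g a.
  rewrite /f; case: cid => b /= /qproj_eq/gker; rewrite rmorphB => /eqP.
  by rewrite subr_eq0 => /eqP.
have fB : zmod_morphism f.
  move=> x y; have [a ->] := qproj_surj x; have [b ->] := qproj_surj y.
  by rewrite -rmorphB !fE rmorphB.
have fM : monoid_morphism f.
  split=> [|x y]; first by rewrite -(rmorph1 (qproj rels)) fE rmorph1.
  have [a ->] := qproj_surj x; have [b ->] := qproj_surj y.
  by rewrite -rmorphM !fE rmorphM.
pose fZ := GRing.isZmodMorphism.Build _ _ f fB.
pose fMM := GRing.isMonoidMorphism.Build _ _ f fM.
pose f' : {rmorphism quotalg rels -> B} := HB.pack f fZ fMM.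
by exists f'.
Qed.

Lemma freealg_lift (I : choiceType) (B : comNzRingType)
    (c : {rmorphism K -> B}) (y : I -> B) :
  exists g : {rmorphism freealg K I -> B},
    (forall k, g (algmap k) = c k) /\ forall i, g (fvar K i) = y i.
Proof.
pose h (m : {fmonom I}) : B := \prod_(i <- (m : seq I)) y i.
have hM : mmorphism h.
  by split=> [m1 m2|]; rewrite /h ?fm1 ?big_nil // fmM big_cat.
pose hm := isMultiplicative.Build _ _ h hM.
pose h' : {mmorphism {fmonom I} -> B} := HB.pack h hm.
exists (mmap c h' : {rmorphism _ -> _}); split=> [k|i].
  exact: mmapC.
rewrite /= /fvar mmapU /= /h fmU big_seq1 -[RHS]mul1r; congr (_ * _).
exact: (rmorph1 c).
Qed.

End Lift.

(** * Entries of endomorphisms of tensor powers *)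

Section TensorEntries.
Variables (n d : nat).
Local Notation idx := {ffun 'I_d -> 'I_n}.

(** Addressing entries by basis tensors hides the enumeration behind [tmx]. *)
Definition tcoef (A : Type) (M : tmx n d A) (u v : idx) : A :=
  M (enum_rank u) (enum_rank v).

Lemma tcoefP (A : Type) (M N : tmx n d A) : tcoef M =2 tcoef N -> M = N.
Proof.
move=> MN; apply/matrixP => i j.
by have := MN (enum_val i) (enum_val j); rewrite /tcoef !enum_valK.
Qed.

Lemma tcoef_of (A : Type) (f : idx -> idx -> A) u v : tcoef (tmx_of f) u v = f u v.
Proof. by rewrite /tcoef mxE !enum_rankK. Qed.

Lemma tcoef_mul (A : pzRingType) (M N : tmx n d A) u v :
  tcoef (M *m N) u v = \sum_w tcoef M u w * tcoef N w v.
Proof.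
rewrite /tcoef mxE (reindex enum_rank) //=.
by apply: onW_bij; exact: enum_rank_bij.
Qed.

Lemma tcoef_map (A B : Type) (g : A -> B) (M : tmx n d A) u v :
  tcoef (map_mx g M) u v = g (tcoef M u v).
Proof. by rewrite /tcoef mxE. Qed.

End TensorEntries.

Section FactorProducts.
Variables (A : pzRingType) (n d : nat) (M : 'M[A]_n).
Local Notation idx := {ffun 'I_d -> 'I_n}.

(** Each factor acts on its own tensor slot, so in the sum over intermediate
    indices a single term survives; the order of the product of entries is that
    of the factors. *)
Lemma tcoef_prod_in_factor (s : seq 'I_d) (u v : idx) : uniq s ->
  tcoef (\big[mulmx/1%:M]_(k <- s) in_factor M k) u v =
  if [forall k, (k \notin s) ==> (u k == v k)] then \prod_(k <- s) M (u k) (v k)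
  else 0.
Proof.
elim: s u => [|k s IHs] u /=.
  rewrite !big_nil /tcoef mxE (inj_eq enum_rank_inj) => _.
  have -> : (u == v) = [forall k, (k \notin [::]) ==> (u k == v k)].
    apply/eqP/forallP => [-> k|uv]; first by rewrite eqxx.
    by apply/ffunP => k; have := uv k; rewrite in_nil => /eqP.
  by case: ifP.
move=> /andP[ks us]; rewrite big_cons tcoef_mul.
(* the only intermediate index: the first factor has already moved slot k *)
pose w0 : idx := [ffun m => if m == k then v k else u m].
have w0k : w0 k = v k by rewrite ffunE eqxx.
have w0m m : m != k -> w0 m = u m by rewrite ffunE => /negPf ->.
rewrite (bigD1 w0) //= big1 ?addr0 => [|w ww0]; last first.
  rewrite tcoef_of; case: ifP => [/forallP uw|_]; last by rewrite mul0r.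
  rewrite IHs //; case: ifP => [/forallP wv|_]; last by rewrite mulr0.
  (* both factors nonzero: w agrees with u off k, and with v at k *)
  case/eqP: ww0; apply/ffunP => m; have [->|mk] := eqVneq m k.
    by rewrite w0k; have := wv k; rewrite ks => /eqP.
  by rewrite w0m //; have := uw m; rewrite mk => /eqP.
rewrite tcoef_of ifT; last first.
  by apply/forallP => m; apply/implyP => mk; rewrite w0m.
rewrite w0k IHs //.
have -> : [forall m, (m \notin s) ==> (w0 m == v m)] =
          [forall m, (m \notin k :: s) ==> (u m == v m)].
  apply: eq_forallb => m; rewrite inE negb_or.
  have [->|mk] := eqVneq m k; first by rewrite w0k eqxx implybT.
  by rewrite w0m.
case: ifP => _; last by rewrite mulr0.
rewrite big_cons; congr (_ * _); apply: eq_big_seq => m ms.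
by rewrite w0m //; apply: contraNneq ks => <-.
Qed.

End FactorProducts.

Lemma map_in_factor n d (A B : pzRingType) (g : {rmorphism A -> B}) (M : 'M[A]_n) (k : 'I_d) :
  map_mx g (in_factor M k) = in_factor (map_mx g M) k.
Proof.
by apply/tcoefP => u v; rewrite tcoef_map !tcoef_of; case: ifP; rewrite ?mxE ?rmorph0.
Qed.

(** * The reflection equation for scalar matrices *)

Section OrderCoefficients.
Variables (A : pzRingType) (m : nat) (w : A).
Implicit Types a b : 'I_m.

(** Rhat is the flip plus q - 1 times the diagonal operator with eigenvalue
    [rcoef (1 + q^-1) a b] on e_a ⊗ e_b ([Rhat_split]); at q = 1 the parameter
    becomes 2. *)
Definition rcoef a b : A :=
  if a == b then 1 else if (a < b)%N then w else 0.

Lemma rcoef_lt a b : (a < b)%N -> rcoef a b = w.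
Proof. by rewrite /rcoef => ab; rewrite ab; case: eqP ab => // ->; rewrite ltnn. Qed.

Lemma rcoef_gt a b : (b < a)%N -> rcoef a b = 0.
Proof.
rewrite /rcoef => ba; rewrite ltnNge (ltnW ba) /=.
by case: eqP ba => // ->; rewrite ltnn.
Qed.

Lemma rcoefxx a : rcoef a a = 1.
Proof. by rewrite /rcoef eqxx. Qed.

End OrderCoefficients.

(** The commutator form of the reflection equation is kept for abstract square
    matrices, so that ring morphisms are pushed through without unfolding the
    tensor indices. *)
Definition RE_diff (B : pzRingType) (m : nat) (Rh Y2 : 'M[B]_m) : 'M[B]_m :=
  Rh *m Y2 *m Rh *m Y2 - Y2 *m Rh *m Y2 *m Rh.

Lemma map_RE_diff (A B : pzRingType) (g : {rmorphism A -> B}) m (Rh Y2 : 'M[A]_m) :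
  map_mx g (RE_diff Rh Y2) = RE_diff (map_mx g Rh) (map_mx g Y2).
Proof. by rewrite /RE_diff map_mxB !map_mxM. Qed.

Definition RE_mx (B : pzRingType) n (Rh : tmx n 2 B) (y : 'M[B]_n) : tmx n 2 B :=
  RE_diff Rh (in_factor y (ord_max : 'I_2)).

Section ScalarReflectionEquation.
Variables (K : comUnitRingType) (q : K) (n : nat) (B : comNzRingType).
Hypothesis q_unit : q \is a GRing.unit.
Variables (g : {rmorphism K -> B}) (y : 'M[B]_n).

Let w := g (1 + q^-1).
Let h := g (q - 1).
Local Notation th := (rcoef w).

Definition idx2 (a b : 'I_n) : {ffun 'I_2 -> 'I_n} :=
  [ffun i => if i == ord0 then a else b].

Lemma idx2_0 a b : idx2 a b ord0 = a. Proof. by rewrite ffunE. Qed.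
Lemma idx2_1 a b : idx2 a b ord_max = b. Proof. by rewrite ffunE. Qed.

Lemma idx2_eta (u : {ffun 'I_2 -> 'I_n}) : u = idx2 (u ord0) (u ord_max).
Proof.
apply/ffunP => i; rewrite ffunE; have [->//|i0] := eqVneq i ord0.
by congr (u _); apply: val_inj; case: i i0 => -[|[|]].
Qed.

Lemma sum_idx2 (f : {ffun 'I_2 -> 'I_n} -> B) :
  \sum_u f u = \sum_a \sum_b f (idx2 a b).
Proof.
rewrite pair_big (reindex (fun p => idx2 p.1 p.2)) //=.
apply: onW_bij; exists (fun u : {ffun 'I_2 -> 'I_n} => (u ord0, u ord_max)).
  by case=> a b; rewrite /= idx2_0 idx2_1.
by move=> u; rewrite [RHS]idx2_eta.
Qed.

Let Rh : tmx n 2 B := map_mx g (Rhat_in q n (ord0 : 'I_2) ord_max).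
Let Y2 : tmx n 2 B := in_factor y (ord_max : 'I_2).

(** The coefficient q - q^-1 of R factors as (q - 1)(1 + q^-1). *)
Lemma Rhat_split (a b c e : 'I_n) :
  g (Rhat q a b c e) = (if a == e then if b == c then 1 else 0 else 0)
    + h * (if a == c then if b == e then th a b else 0 else 0).
Proof.
rewrite /Rhat /Rmat /rcoef /h /w.
have hw : g (q - 1) * g (1 + q^-1) = g (q - q^-1).
  by rewrite -rmorphM mulrDr mulr1 mulrBl divrr // mul1r addrA subrK.
have [<-|bc] := eqVneq b c; have [<-|ae] := eqVneq a e; rewrite ?eqxx ?andbT ?add0r /=.
- have [_|ba] := eqVneq b a; rewrite ?eqxx /=.
    by rewrite rmorphB rmorph1 mulr1 addrC subrK.
  by rewrite rmorph1 mulr0 addr0.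
- rewrite !andbF ltnn rmorph0; have [ab|_] := eqVneq a b; last by rewrite mulr0.
  by rewrite ab in ae; rewrite (negPf ae) mulr0.
- have [ac|ac] := eqVneq a c; last by rewrite !andbF rmorph0 mulr0.
  by rewrite -ac in bc; rewrite (negPf bc) !andbF rmorph0 mulr0.
- have [be|be] := eqVneq b e; last by rewrite andbF rmorph0 if_same mulr0.
  have [<-|ac] := eqVneq a c; last by rewrite !andbF rmorph0 mulr0.
  rewrite -be in ae; rewrite (negPf ae) andbT.
  by rewrite ?andbT; case: ifP => _; rewrite ?hw ?rmorph0 ?mulr0.
Qed.

Lemma tcoef_Rh a b c e : tcoef Rh (idx2 a b) (idx2 c e) = g (Rhat q a b c e).
Proof.
rewrite tcoef_map tcoef_of !idx2_0 !idx2_1 ifT //.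
apply/forallP => i; apply/implyP => /andP[].
by case: i => -[|[|]].
Qed.

Lemma tcoef_Y2 a b c e : tcoef Y2 (idx2 a b) (idx2 c e) = if a == c then y b e else 0.
Proof.
rewrite tcoef_of !idx2_1; congr (if _ then _ else _).
apply/forallP/idP => [/(_ ord0)|ac i]; rewrite ?idx2_0 //.
by apply/implyP; case: i => -[|[|]] // i0 _; rewrite !ffunE.
Qed.

Lemma sum_delta (m : nat) (i : 'I_m) (f : 'I_m -> B) :
  \sum_s (if i == s then f s else 0) = f i.
Proof. by rewrite (bigD1 i) //= eqxx big1 ?addr0 // => s; rewrite eq_sym => /negPf->. Qed.

Lemma tcoef_RhM (M : tmx n 2 B) a b c e : tcoef (Rh *m M) (idx2 a b) (idx2 c e)
  = tcoef M (idx2 b a) (idx2 c e) + h * (th a b * tcoef M (idx2 a b) (idx2 c e)).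
Proof.
rewrite tcoef_mul sum_idx2.
under eq_bigr => s _ do under eq_bigr => t _ do
  rewrite tcoef_Rh Rhat_split mulrDl -mulrA.
under eq_bigr => s _ do rewrite big_split /= -mulr_sumr.
rewrite big_split /= -mulr_sumr; congr (_ + h * _).
  rewrite -[RHS](sum_delta b (fun s => tcoef M (idx2 s a) (idx2 c e))).
  apply: eq_bigr => s _.
  rewrite -(sum_delta a (fun t => if b == s then tcoef M (idx2 s t) (idx2 c e) else 0)).
  by apply: eq_bigr => t _; do 2?[case: ifP]; rewrite ?mul1r ?mul0r.
rewrite -(sum_delta a (fun s => th a b * tcoef M (idx2 s b) (idx2 c e))).
apply: eq_bigr => s _.
rewrite -(sum_delta b (fun t => if a == s then th a b * tcoef M (idx2 s t) (idx2 c e) else 0)).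
by apply: eq_bigr => t _; do 2?[case: ifP]; rewrite ?mul0r.
Qed.

Lemma tcoef_MRh (M : tmx n 2 B) a b c e : tcoef (M *m Rh) (idx2 a b) (idx2 c e)
  = tcoef M (idx2 a b) (idx2 e c) + h * (th c e * tcoef M (idx2 a b) (idx2 c e)).
Proof.
rewrite tcoef_mul sum_idx2.
under eq_bigr => s _ do under eq_bigr => t _ do
  rewrite tcoef_Rh Rhat_split mulrDr mulrCA.
under eq_bigr => s _ do rewrite big_split /= -mulr_sumr.
rewrite big_split /= -mulr_sumr; congr (_ + h * _).
  rewrite -[RHS](sum_delta e (fun s => tcoef M (idx2 a b) (idx2 s c))).
  apply: eq_bigr => s _.
  rewrite -(sum_delta c (fun t => if e == s then tcoef M (idx2 a b) (idx2 s t) else 0)).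
  apply: eq_bigr => t _; rewrite [e == s]eq_sym [c == t]eq_sym.
  by do 2?[case: ifP]; rewrite ?mulr1 ?mulr0.
rewrite -(sum_delta c (fun s => th c e * tcoef M (idx2 a b) (idx2 s e))).
apply: eq_bigr => s _.
rewrite -(sum_delta e (fun t => if c == s then th c e * tcoef M (idx2 a b) (idx2 s t) else 0)).
apply: eq_bigr => t _; rewrite [e == t]eq_sym [c == s]eq_sym.
by case: (eqVneq s c) => [->|_]; case: (eqVneq t e) => [->|_]; rewrite ?mulr0 // mulrC.
Qed.

Lemma tcoef_Y2M (M : tmx n 2 B) a b c e :
  tcoef (Y2 *m M) (idx2 a b) (idx2 c e) = \sum_t y b t * tcoef M (idx2 a t) (idx2 c e).
Proof.
rewrite tcoef_mul sum_idx2.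
rewrite -(sum_delta a (fun s => \sum_t y b t * tcoef M (idx2 s t) (idx2 c e))).
apply: eq_bigr => s _; under eq_bigr => t _ do rewrite tcoef_Y2.
by case: ifP => // _; rewrite big1 // => t _; rewrite mul0r.
Qed.

Let S a b c := \sum_t th a t * (y b t * y t c).

Lemma tcoef_Y2RhY2 a b c e : tcoef (Y2 *m Rh *m Y2) (idx2 a b) (idx2 c e)
  = y b c * y a e + h * (if a == c then S a b e else 0).
Proof.
rewrite -mulmxA tcoef_Y2M; under eq_bigr => t _ do rewrite tcoef_RhM !tcoef_Y2 mulrDr mulrCA.
rewrite big_split /= -mulr_sumr; congr (_ + h * _).
  rewrite -(sum_delta c (fun t => y b t * y a e)); apply: eq_bigr => t _.
  by rewrite eq_sym; case: ifP => // _; rewrite mulr0.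
case: ifP => _; first by apply: eq_bigr => t _; rewrite mulrCA.
by rewrite big1 // => t _; rewrite !mulr0.
Qed.

(** For scalar matrices the terms of order 0 in q - 1 cancel, because the
    entries commute. The term of order 1 is the quadratic Poisson bracket, which
    is what survives after division by q - 1. *)
Lemma RE_entry a b c e :
  tcoef (RE_mx Rh y) (idx2 a b) (idx2 c e) =
  h * ((th a b - th c e) * (y b c * y a e)
       + (if b == c then S b a e else 0) - (if a == e then S a b c else 0)
       + h * ((th a b - th c e) * (if a == c then S a b e else 0))).
Proof.
rewrite /RE_mx /RE_diff -/Y2 /tcoef mxE [X in _ + X]mxE.
rewrite -!/(tcoef _ (idx2 a b) (idx2 c e)).
rewrite -!mulmxA tcoef_RhM !mulmxA tcoef_MRh !tcoef_Y2RhY2.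
by ring.
Qed.

End ScalarReflectionEquation.

Section Characters.
Variables (F : fieldType) (n : nat).
Local Notation K := (locK F).
Local Notation q := (locK_q F).
Local Notation Free := (freealg K ('I_n * 'I_n)%type).

Lemma map_RE_mx (B : pzRingType) (c : K -> B) (g : {rmorphism Free -> B}) :
  (forall k, g (algmap k) = c k) ->
  map_mx g (RE_mx (scalar_tmx Free (Rhat_in q n (ord0 : 'I_2) ord_max)) (varmx K n))
  = RE_mx (map_mx c (Rhat_in q n (ord0 : 'I_2) ord_max)) (map_mx g (varmx K n)).
Proof.
move=> gc; rewrite /RE_mx map_RE_diff map_in_factor; congr RE_diff.
have -> : map_mx g (scalar_tmx Free (Rhat_in q n (ord0 : 'I_2) ord_max))
    = map_mx c (Rhat_in q n (ord0 : 'I_2) ord_max).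
  by apply/matrixP => a b; rewrite !mxE gc.
by [].
Qed.

(** At q = 1 the reflection equation only says that the generators commute, so
    every matrix gives a point. *)
Lemma classical_character (J : 'M[F]_n) :
  exists chi : {rmorphism LqM q n -> F},
    (forall k, chi (algmap k) = at_one k) /\ map_mx chi (Lmx q n) = J.
Proof.
have [g [gK gJ]] := @freealg_lift K _ F (@at_one F) (fun p : 'I_n * 'I_n => J p.1 p.2).
have gV : map_mx g (varmx K n) = J by apply/matrixP => i j; rewrite !mxE gJ.
have gRE x : @RE_rels K q n x -> g x = 0.
  move=> [a [b ->]].
  have := map_RE_mx gK; rewrite gV => /matrixP/(_ a b); rewrite mxE => ->.
  have -> : RE_mx (map_mx (@at_one F) (Rhat_in q n (ord0 : 'I_2) ord_max)) J = 0.
    apply/tcoefP => u v.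
    rewrite [u]idx2_eta [v]idx2_eta.
    rewrite (RE_entry (locK_q_unit F) (@at_one F)).
    by rewrite rmorphB rmorph1 /= at_one_q subrr mul0r /tcoef mxE.
  by rewrite mxE.
have [chi chiE] := quotalg_lift gRE.
exists chi; split=> [k|]; first by rewrite -gK -chiE.
by apply/matrixP => i j; rewrite !mxE chiE -gV !mxE.
Qed.

Lemma RE_character (f : {rmorphism LqM q n -> K}) :
  (forall k, f (algmap k) = k) ->
  RE_mx (Rhat_in q n (ord0 : 'I_2) ord_max) (map_mx f (Lmx q n)) = 0.
Proof.
move=> fK.
pose p : {rmorphism Free -> LqM q n} := qproj (@RE_rels K q n).
pose g : {rmorphism Free -> K} := f \o p.
have gK k : g (algmap k) = id k by rewrite /= -[RHS]fK.
have := map_RE_mx gK.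
have -> : map_mx g (varmx K n) = map_mx f (Lmx q n).
  by apply/matrixP => i j; rewrite !mxE.
rewrite map_mx_id => // <-; apply/matrixP => a b; rewrite mxE [RHS]mxE.
rewrite -(rmorph0 f); congr (f _).
apply: etrans (rmorph0 p); apply/qproj_eq; rewrite subr0.
by apply: ideal_gen_rel; exists a, b.
Qed.

(** K is a domain, so the reflection equation may be divided by q - 1 before q is
    set to 1. *)
Lemma RE_first_order (Y : 'M[K]_n) :
  RE_mx (Rhat_in q n (ord0 : 'I_2) ord_max) Y = 0 ->
  let y := map_mx (@at_one F) Y in
  forall a b c d,
  (rcoef 2 a b - rcoef 2 c d) * (y b c * y a d)
  + (if b == c then \sum_s rcoef 2 b s * (y a s * y s d) else 0)
  - (if a == d then \sum_s rcoef 2 a s * (y b s * y s c) else 0) = 0.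
Proof.
move=> RE0 y a b c d.
have rcE i j : at_one (rcoef (1 + q^-1) i j) = rcoef 2 i j :> F.
  rewrite /rcoef; case: ifP => _; first exact: rmorph1.
  case: ifP => _; last exact: rmorph0.
  by rewrite rmorphD rmorph1 rmorphV ?locK_q_unit //= at_one_q invr1.
have := RE_entry (locK_q_unit F) (idfun : {rmorphism K -> K}) Y a b c d.
rewrite map_mx_id // RE0 /tcoef mxE /= => /esym/eqP.
rewrite mulf_eq0 (negPf (locK_q_neq1 F)) /= => /eqP/(congr1 (@at_one F)).
rewrite rmorph0 rmorphD rmorphM (rmorphB (@at_one F) q) rmorph1 /= at_one_q subrr mul0r addr0.
rewrite rmorphB rmorphD rmorphM rmorphB rmorphM /= !rcE.
have yE i j : at_one (Y i j) = y i j by rewrite mxE.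
have sumE (t : bool) i j k : at_one (if t then
    \sum_s rcoef (1 + q^-1) i s * (Y j s * Y s k) else 0) =
    if t then \sum_s rcoef 2 i s * (y j s * y s k) else 0.
  case: t; last exact: rmorph0.
  by rewrite rmorph_sum; apply: eq_bigr => s _; rewrite !rmorphM /= rcE !yE.
by rewrite !sumE !yE.
Qed.

End Characters.

(** * Matrices at which the Poisson bracket vanishes *)

(** The minimal polynomial of M divides x(x - l), or x(x^2 - l x - c) with c
    nonzero: M has at most two nonzero eigenvalues, and 0 is at most a simple
    root unless l = 0 and M^2 = 0. *)
Definition low_degree_relation (F : fieldType) n (M : 'M[F]_n) (l c : F) : Prop :=
  M *m M = l *: M \/ c != 0 /\ M *m M *m M = l *: (M *m M) + c *: M.

Section Poisson.
Variables (F : fieldType) (n : nat) (y : 'M[F]_n.+1).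

Local Notation th := (rcoef (2 : F)).

Hypothesis two_neq0 : 2 != 0 :> F.
(** Up to normalization, the left-hand side is the Poisson bracket of the
    coordinates (a, c) and (b, d), evaluated at y. *)
Hypothesis bracket0 : forall a b c d : 'I_n.+1,
  (th a b - th c d) * (y b c * y a d)
  + (if b == c then \sum_s th b s * (y a s * y s d) else 0)
  - (if a == d then \sum_s th a s * (y b s * y s c) else 0) = 0.

Let l := y 0 0.

Lemma ord_gt0 (a : 'I_n.+1) : a != 0 -> ((0%R : 'I_n.+1) < a)%N.
Proof. by rewrite -val_eqE /= lt0n. Qed.

(** The two sums in the bracket only enter when b = c or a = d. *)
Lemma off_diag_product0 a b c d : b != c -> a != d -> th a b != th c d ->
  y b c * y a d = 0.
Proof.
move=> bc ad abcd; have := bracket0 a b c d.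
rewrite (negPf bc) (negPf ad) addr0 subr0 => /eqP.
by rewrite mulf_eq0 subr_eq0 (negPf abcd) => /eqP.
Qed.

(** For varying b, these equations truncate the sum defining an off-diagonal
    entry of y^2 at different places. *)
Lemma half_square_off_diag a b d : a != d ->
  \sum_s th b s * (y a s * y s d) = (th b d - th a b) * (y b b * y a d).
Proof.
move=> ad; have := bracket0 a b b d.
by rewrite eqxx (negPf ad) subr0 => /eqP; rewrite addrC addr_eq0 -mulNr opprB => /eqP.
Qed.

Lemma row_off_diag_uniq a s t : a != s -> a != t -> s != t -> y a s * y a t = 0.
Proof.
move=> as_ at_ st; apply: off_diag_product0 => //; rewrite rcoefxx /rcoef (negPf st).
case: ifP => _; last exact: oner_neq0.
by rewrite -subr_eq0 opprD addrA subrr sub0r oppr_eq0 oner_eq0.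
Qed.

(** A nonzero entry (a, 0) is the only off-diagonal one in its row, so (a, d) and
    every detour from a to d through an index other than 0 vanish; the truncated
    sum at b = 0 then reduces to the product in question. *)
Lemma no_path_through_0 a d : a != 0 -> d != 0 -> a != d -> y a 0 * y 0 d = 0.
Proof.
move=> a0 d0 ad; have [->|ya0] := eqVneq (y a 0) 0; first by rewrite mul0r.
have yas s : s != 0 -> s != a -> y a s = 0.
  rewrite eq_sym => s0; rewrite eq_sym => sa.
  by have /eqP := row_off_diag_uniq a0 sa s0; rewrite mulf_eq0 (negPf ya0) => /eqP.
have yad : y a d = 0 by apply: yas; rewrite // eq_sym.
have := half_square_off_diag 0 ad; rewrite yad !mulr0 (bigD1 0) //= rcoefxx mul1r.
rewrite big1 ?addr0 // => s s0; have [->|sa] := eqVneq s a.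
  by rewrite yad !mulr0.
by rewrite yas // mul0r mulr0.
Qed.

(** The diagonal entries of y^2 - l y, by [square_diag] below. *)
Let tail (b : 'I_n.+1) := \sum_(s : 'I_n.+1 | (b <= s)%N && (s != 0)) y 0 s * y s 0.

(** The truncation at index 0 omits nothing but half of the term s = 0, so it is
    essentially the full entry of 2 y^2. *)
Lemma square_off_diag a d : a != d -> (y *m y) a d = l * y a d.
Proof.
move=> ad; have := half_square_off_diag 0 ad.
have -> : \sum_s th 0 s * (y a s * y s d) = 2 * (y *m y) a d - y a 0 * y 0 d.
  rewrite mxE mulr_sumr [in RHS](bigD1 0) //= [in LHS](bigD1 0) //= rcoefxx.
  rewrite [X in _ + X = _](eq_bigr (fun s => 2 * (y a s * y s d))).
    by ring.
  by move=> s s0; rewrite rcoef_lt // ord_gt0.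
have [a0|a0] := eqVneq a 0.
  move: ad; rewrite a0 => d0; rewrite rcoefxx rcoef_lt ?ord_gt0 1?eq_sym //.
  move=> /eqP; rewrite subr_eq => /eqP H; apply: (mulfI two_neq0); rewrite H /l.
  ring.
have a0' := ord_gt0 a0.
rewrite (rcoef_gt _ a0') subr0; have [d0|d0] := eqVneq d 0.
  rewrite d0 rcoefxx; move=> /eqP; rewrite subr_eq => /eqP H.
  by apply: (mulfI two_neq0); rewrite H /l; ring.
rewrite rcoef_lt ?ord_gt0 // no_path_through_0 // subr0 -/l => H.
by apply: (mulfI two_neq0).
Qed.

(** The bracket of the entries (0, b) and (b, 0) compares the sum truncated at 0
    along row b with the sum truncated at b along row 0. Up to a factor 2 and to the
    halved boundary terms, the former is a diagonal entry of y^2 and the latter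
    is [tail b]. *)
Lemma square_diag b : (y *m y) b b = l * y b b + tail b.
Proof.
have [->|b0] := eqVneq b 0.
  by rewrite mxE (bigD1 0) //= /tail /l; congr (_ + _); apply: eq_bigl => s; rewrite andTb.
have b0' := ord_gt0 b0.
have := bracket0 0 b b 0; rewrite !eqxx (rcoef_lt _ b0') (rcoef_gt _ b0').
have -> : \sum_s th 0 s * (y b s * y s b) = 2 * (y *m y) b b - y b 0 * y 0 b.
  rewrite mxE mulr_sumr [in RHS](bigD1 0) //= [in LHS](bigD1 0) //= rcoefxx.
  rewrite [X in _ + X = _](eq_bigr (fun s => 2 * (y b s * y s b))).
    by ring.
  by move=> s s0; rewrite rcoef_lt // ord_gt0.
have -> : \sum_s th b s * (y 0 s * y s 0) = 2 * tail b - y 0 b * y b 0.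
  rewrite /tail mulr_sumr [in RHS](bigD1 b) ?leqnn //=.
  rewrite [in LHS](bigID (fun s : 'I_n.+1 => (b <= s)%N && (s != 0))) /=.
  rewrite [X in _ + X]big1 ?addr0 => [|s].
    rewrite (bigD1 b) ?leqnn //= rcoefxx.
    rewrite [X in _ + X = _](eq_bigr (fun s => 2 * (y 0 s * y s 0))).
      by ring.
    by move=> s /andP[/andP[bs s0] sb]; rewrite rcoef_lt // ltn_neqAle bs eq_sym andbT.
  have [->|s0] := eqVneq s 0; first by rewrite rcoef_gt ?mul0r.
  by rewrite andbT -ltnNge => sb; rewrite rcoef_gt ?mul0r.
move=> /eqP; rewrite subr_eq0 => /eqP H.
apply: (mulfI two_neq0).
have -> : 2 * (y *m y) b b = (2 * (y *m y) b b - y b 0 * y 0 b) + y b 0 * y 0 b.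
  by rewrite subrK.
by rewrite -H /l; ring.
Qed.

(** By the two previous lemmas y^2 - l y is the diagonal matrix of the [tail b].
    It vanishes when all products y_0s y_s0 do. Otherwise exactly one
    index m contributes, the tails are c = y_0m y_m0 up to index m and 0 beyond,
    and all columns of y beyond m vanish, so that y(y^2 - l y) = c y. *)
Lemma poisson_zero_relation : exists l c : F, low_degree_relation y l c.
Proof.
have [all0|] := boolP [forall s, (s != 0) ==> (y 0 s * y s 0 == 0)].
  exists l, 0; left; apply/matrixP => a d; rewrite [RHS]mxE.
  have [<-|/square_off_diag //] := eqVneq a d; rewrite square_diag /tail big1 ?addr0 //.
  by move=> s /andP[_ s0]; apply/eqP; move/forallP/(_ s): all0; rewrite s0.
rewrite negb_forall => /existsP[m]; rewrite negb_imply => /andP[m0 cm].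
have /andP[y0m ym0] : (y 0 m != 0) && (y m 0 != 0) by rewrite -negb_or -mulf_eq0.
have y0s s : s != 0 -> s != m -> y 0 s = 0.
  rewrite eq_sym => s0; rewrite eq_sym => sm; have m0s : 0 != m by rewrite eq_sym.
  by have /eqP := row_off_diag_uniq m0s s0 sm; rewrite mulf_eq0 (negPf y0m) => /eqP.
have tailE b : tail b = if (b <= m)%N then y 0 m * y m 0 else 0.
  case: ifP => bm.
    rewrite /tail (bigD1 m) ?bm //= big1 ?addr0 // => s /andP[/andP[_ s0] sm].
    by rewrite y0s ?mul0r.
  apply: big1 => s /andP[bs s0]; rewrite y0s ?mul0r //.
  by apply: contraFN bm => /eqP <-.
have m0' := ord_gt0 m0.
have col0 a (b : 'I_n.+1) : (m < b)%N -> y a b = 0.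
  move=> mb; have b0' := ltn_trans m0' mb.
  have b0 : b != 0 by rewrite -val_eqE /= -lt0n.
  have [->|a0] := eqVneq a 0.
    by apply: y0s => //; apply: contraTN mb => /eqP ->; rewrite ltnn.
  have a0' := ord_gt0 a0.
  have [->|ab] := eqVneq a b.
    have := @half_square_off_diag 0 b m; rewrite eq_sym m0 => /(_ isT).
    rewrite (rcoef_gt _ mb) (rcoef_lt _ b0') sub0r big1 => [/esym/eqP|s _].
      by rewrite mulf_eq0 oppr_eq0 (negPf two_neq0) mulf_eq0 (negPf y0m) orbF => /eqP.
    case: (ltnP s b) => sb; first by rewrite rcoef_gt ?mul0r.
    have ms := leq_trans mb sb.
    rewrite y0s ?mul0r ?mulr0 //; first by rewrite -val_eqE /= -lt0n (leq_trans _ ms).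
    by apply: contraTN ms => /eqP ->; rewrite ltnn.
  have := @off_diag_product0 0 a b m ab; rewrite eq_sym m0 => /(_ isT).
  rewrite (rcoef_gt _ mb) (rcoef_lt _ a0') => /(_ two_neq0)/eqP.
  by rewrite mulf_eq0 (negPf y0m) orbF => /eqP.
exists l, (y 0 m * y m 0); right; split=> //.
have yy : y *m y = l *: y + diag_mx (\row_b tail b).
  apply/matrixP => a d; rewrite ![in RHS]mxE.
  by case: eqVneq => [<-|/square_off_diag ->]; rewrite ?square_diag ?mulr1n // mulr0n addr0.
rewrite -mulmxA {1}yy mulmxDr -scalemxAr; congr (_ + _).
rewrite mul_mx_diag; apply/matrixP => a d; rewrite !mxE tailE.
case: ifP => dm; first by rewrite mulrC.
by rewrite (col0 a) ?mul0r ?mulr0 // ltnNge dm.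
Qed.

End Poisson.

(** * Jordan forms violating the low-degree relations *)

Section JordanObstruction.
Variables (F : fieldType) (n : nat).

(** Entry (0, 1) is 1 in J and 0 in J^2 and J^3, so the cubic relation would force
    c = 0 and the quadratic one l = 0, that is J^2 = 0. The latter fails at
    (0, 2) if the block has size at least 3, and at the first nonzero
    eigenvalue, in position (2, 2), if it has size 2. *)
Lemma jordan_block_obstruction r (lam : seq F) l c :
  size lam = (n - r)%N -> 0 \notin lam -> (r <= n)%N ->
  (1 < r)%N -> (2 < n)%N -> ~ low_degree_relation (jordan_mx n r lam) l c.
Proof.
move=> szl lam0 rn r1 n2; set J := jordan_mx n r lam.
have n0 : (0 < n)%N by lia.
have n1 : (1 < n)%N by lia.
pose o0 := Ordinal n0; pose o1 := Ordinal n1; pose o2 := Ordinal n2.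
have row0 (M : 'M[F]_n) j : (J *m M) o0 j = M o1 j.
  rewrite mxE (bigD1 o1) //= big1 ?addr0 => [|k /negPf k1].
    by rewrite mxE /= r1 (ltnW r1) /= mul1r.
  rewrite mxE /= (ltnW r1) /=; case: ifP => kr.
    by rewrite -val_eqE /= in k1; rewrite k1 mul0r.
  case: eqVneq kr => [<-|_ _]; last by rewrite mul0r.
  by rewrite /= (ltnW r1).
have J01 : J o0 o1 = 1 by rewrite mxE /= r1 (ltnW r1).
have J11 : J o1 o1 = 0 by rewrite mxE /= r1.
have JJ11 : (J *m J) o1 o1 = 0.
  rewrite mxE big1 // => k _; rewrite mxE [J k o1]mxE /= r1 /=.
  case: (ltnP k r) => kr /=.
    by case: eqP => [->|]; rewrite ?mul0r // mulr0.
  by case: (eqVneq k o1) kr => [->|_ _]; rewrite ?mulr0 //= leqNgt r1.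
case=> [JJ|[c0 JJJ]]; last first.
  have := congr1 (fun M : 'M[F]_n => M o0 o1) JJJ.
  rewrite -mulmxA row0 JJ11 mxE [in RHS]mxE row0 J11 mxE J01 mulr0 add0r mulr1.
  by move=> /esym/eqP; rewrite (negPf c0).
have l0 : l = 0.
  have := congr1 (fun M : 'M[F]_n => M o0 o1) JJ.
  by rewrite row0 J11 mxE J01 mulr1.
move: JJ; rewrite l0 scale0r => JJ.
have [r2|r2] := ltnP 2 r.
  have := congr1 (fun M : 'M[F]_n => M o0 o2) JJ.
  by rewrite row0 !mxE /= r1 r2 => /eqP; rewrite oner_eq0.
have rE : r = 2%N by lia.
have row2 k : J o2 k = if o2 == k then lam`_0 else 0 by rewrite mxE rE.
have := congr1 (fun M : 'M[F]_n => M o2 o2) JJ.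
rewrite mxE (bigD1 o2) //= big1 ?addr0 => [|k]; last first.
  by rewrite eq_sym row2 => /negPf ->; rewrite mul0r.
rewrite !row2 eqxx mxE => /eqP; rewrite mulf_eq0 orbb => /eqP lam00.
by move/negP: lam0; apply; rewrite -lam00 mem_nth // szl rE subn_gt0.
Qed.

Lemma eigenvalue_square (M : 'M[F]_n) l a :
  M *m M = l *: M -> eigenvalue M a -> a != 0 -> a = l.
Proof.
move=> MM /eigenvalueP[v vM v0] a0; apply: (mulfI a0); apply/eqP.
have : (a * a - l * a) *: v = 0.
  rewrite scalerBl -!scalerA -vM scalemxAl -vM -mulmxA MM -scalemxAr vM.
  by rewrite subrr.
by move/eqP; rewrite scaler_eq0 (negPf v0) orbF subr_eq0 [l * a]mulrC.
Qed.

Lemma eigenvalue_cube (M : 'M[F]_n) l c a :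
  M *m M *m M = l *: (M *m M) + c *: M -> eigenvalue M a -> a != 0 ->
  a ^+ 2 = l * a + c.
Proof.
move=> MMM /eigenvalueP[v vM v0] a0; apply: (mulfI a0); apply/eqP.
have vMM : v *m (M *m M) = (a * a) *: v.
  by rewrite mulmxA vM -scalemxAl vM scalerA.
have vMMM : v *m (M *m M *m M) = (a * a * a) *: v.
  by rewrite mulmxA vMM -scalemxAl vM scalerA.
have : (a * a ^+ 2 - a * (l * a + c)) *: v = 0.
  rewrite (_ : a * a ^+ 2 = a * a * a); last by ring.
  rewrite (_ : a * (l * a + c) = l * (a * a) + c * a); last by ring.
  rewrite scalerBl -vMMM MMM mulmxDr -!scalemxAr vMM vM !scalerA scalerDl.
  by rewrite subrr.
by move/eqP; rewrite scaler_eq0 (negPf v0) orbF subr_eq0.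
Qed.

(** Two distinct roots of x^2 - l x - c sum to l, so a third root would coincide
    with one of them. *)
Lemma three_eigenvalues_obstruction (M : 'M[F]_n) l c (s : seq F) :
  size s = 3%N -> uniq s -> (forall a, a \in s -> a != 0 /\ eigenvalue M a) ->
  ~ low_degree_relation M l c.
Proof.
case: s => [|a [|b [|e [|]]]] // _ /=; rewrite !inE andbT negb_or.
move=> /andP[/andP[ab ae] be] sE.
have [[a0 aM] [b0 bM] [e0 eM]] : [/\ a != 0 /\ eigenvalue M a,
    b != 0 /\ eigenvalue M b & e != 0 /\ eigenvalue M e].
  by split; apply: sE; rewrite !inE eqxx ?orbT.
case=> [MM|[_ MMM]].
  by case/eqP: ab; rewrite (eigenvalue_square MM aM) // (eigenvalue_square MM bM).
have sum x y : x != y -> x ^+ 2 = l * x + c -> y ^+ 2 = l * y + c -> x + y = l.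
  move=> xy x2 y2; have xy0 : x - y != 0 by rewrite subr_eq0.
  apply: (mulfI xy0).
  have -> : (x - y) * (x + y) = x ^+ 2 - y ^+ 2 by ring.
  by rewrite x2 y2; ring.
have a2 := eigenvalue_cube MMM aM a0.
have b2 := eigenvalue_cube MMM bM b0.
have e2 := eigenvalue_cube MMM eM e0.
case/eqP: be; apply: (addrI a).
by rewrite (sum a b) // (sum a e).
Qed.

End JordanObstruction.

(** * The map Phi at q = 1 *)

Section Swap.
Variables (F : fieldType) (n d : nat).
Local Notation q := (locK_q F).
Local Notation idx := {ffun 'I_d -> 'I_n}.

Definition swapf (k k' : 'I_d) (u : idx) : idx := [ffun m => u (tperm k k' m)].

Lemma swapfK k k' : involutive (swapf k k').
Proof. by move=> u; apply/ffunP => m; rewrite !ffunE tpermK. Qed.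

Lemma at_one_Rhat (a b c e : 'I_n) :
  at_one (Rhat q a b c e) = ((a == e) && (b == c))%:R.
Proof.
rewrite (Rhat_split (locK_q_unit F) (@at_one F)) rmorphB rmorph1 /= at_one_q subrr.
by rewrite mul0r addr0; case: ifP => //= _; case: ifP.
Qed.

Variables (k k' : 'I_d).
Let Rh := Rhat_in q n k k'.
Let P : tmx n d F := map_mx (@at_one F) Rh.

Lemma tcoef_at_one_Rhat u v : tcoef P u v = (u == swapf k k' v)%:R.
Proof.
rewrite tcoef_map tcoef_of.
have -> : (u == swapf k k' v) =
    [forall m, (m != k) && (m != k') ==> (u m == v m)]
    && ((u k == v k') && (u k' == v k)).
  apply/eqP/and3P => [->|[/forallP uv /eqP ukv /eqP uk'v]].
    split; rewrite ?ffunE ?tpermL ?tpermR //.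
    by apply/forallP => m; apply/implyP => /andP[mk mk']; rewrite ffunE tpermD // eq_sym.
  apply/ffunP => m; rewrite ffunE; case: tpermP => [->|->|/eqP mk /eqP mk'] //.
  by have := uv m; rewrite mk mk' => /eqP.
case: ifP => _; last exact: (rmorph0 (@at_one F)).
by rewrite at_one_Rhat.
Qed.

Lemma tcoef_swap_mul (M : tmx n d F) u v : tcoef (P *m M) u v = tcoef M (swapf k k' u) v.
Proof.
rewrite tcoef_mul (bigD1 (swapf k k' u)) //= tcoef_at_one_Rhat swapfK eqxx mul1r.
rewrite big1 ?addr0 // => w wu; rewrite tcoef_at_one_Rhat.
by case: (eqVneq u (swapf k k' w)) wu => [->|_ _]; rewrite ?swapfK ?eqxx ?mul0r.
Qed.

Lemma tcoef_mul_swap (M : tmx n d F) u v : tcoef (M *m P) u v = tcoef M u (swapf k k' v).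
Proof.
rewrite tcoef_mul (bigD1 (swapf k k' v)) //= tcoef_at_one_Rhat eqxx mulr1.
rewrite big1 ?addr0 // => w /negPf wv.
by rewrite tcoef_at_one_Rhat wv mulr0.
Qed.

(** At q = 1 Rhat is a flip, hence invertible; a matrix over K that is invertible
    at q = 1 is invertible since K is local. *)
Lemma Rhat_in_unit : Rh \in unitmx.
Proof.
rewrite unitmxE at_one_unit // -det_map_mx -/P.
have PP : P *m P = 1%:M.
  apply/tcoefP => u v; rewrite tcoef_swap_mul tcoef_at_one_Rhat.
  by rewrite (inj_eq (can_inj (swapfK k k'))) /tcoef mxE (inj_eq enum_rank_inj).
by have /mulmx1_unit[] := PP; rewrite unitmxE unitfE.
Qed.

Lemma swap_conj_in_factor (J : 'M[F]_n) :
  P *m in_factor J k' *m map_mx (@at_one F) (invmx Rh) = in_factor J k.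
Proof.
have -> : P *m in_factor J k' = in_factor J k *m P.
  apply/tcoefP => u v; rewrite tcoef_swap_mul tcoef_mul_swap !tcoef_of !ffunE.
  rewrite tpermL tpermR; congr (if _ then _ else _).
  apply/forallP/forallP => uv m; have := uv (tperm k k' m); rewrite !ffunE ?tpermK.
    by rewrite -(inj_eq (@perm_inj _ (tperm k k'))) tpermK tpermR.
  by rewrite -(inj_eq (@perm_inj _ (tperm k k'))) tpermK tpermL.
by rewrite -mulmxA -map_mxM mulmxV ?Rhat_in_unit // map_mx1 mulmx1.
Qed.

End Swap.

Section ClassicalPhi.
Variables (F : fieldType) (n : nat).
Local Notation K := (locK F).
Local Notation q := (locK_q F).
Variable chi : {rmorphism LqM q n -> F}.
Hypothesis chi_scalar : forall k : K, chi (algmap k) = at_one k.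
Let J : 'M[F]_n := map_mx chi (Lmx q n).

Lemma character_scalar_tmx d (M : tmx n d K) :
  map_mx chi (scalar_tmx (LqM q n) M) = map_mx (@at_one F) M.
Proof. by apply/matrixP => a b; rewrite !mxE chi_scalar. Qed.

(** At q = 1 the conjugation by Rhat that defines L_(k) from L_(k+1) is
    the conjugation by a flip, which moves the matrix by one tensor slot. *)
Lemma character_Lfactor d j : (j <= d)%N ->
  map_mx chi (Lfactor q n d j) = in_factor J (inord (d - j) : 'I_d.+1).
Proof.
elim: j => [|j IHj] jd.
  by rewrite map_in_factor subn0; congr in_factor; apply: val_inj; rewrite /= inordK.
by rewrite !map_mxM !character_scalar_tmx IHj ?(ltnW jd) // swap_conj_in_factor.
Qed.

(** The factors L_(d), ..., L_(1) come in decreasing order, which is immaterial in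
    the commutative ring F. *)
Lemma character_prod_Lfactor d (u v : {ffun 'I_d.+1 -> 'I_n}) :
  tcoef (map_mx chi (\big[mulmx/1%:M]_(j < d.+1) Lfactor q n d j)) u v =
  \prod_k J (u k) (v k).
Proof.
have chiM : {morph @map_mx _ _ chi #|{: {ffun 'I_d.+1 -> 'I_n}}| _ : M N / M *m N}.
  by move=> M N; rewrite map_mxM.
rewrite (big_morph _ chiM (map_mx1 chi _)).
rewrite (eq_bigr (fun j : 'I_d.+1 => in_factor J (rev_ord j))) => [|j _]; last first.
  have jd : (j <= d)%N by rewrite -ltnS.
  have ej : inord (d - j) = rev_ord j by apply: val_inj; rewrite /= inordK ?subSS // ltnS leq_subr.
  by rewrite (character_Lfactor jd) ej.
rewrite -(big_map (@rev_ord d.+1) xpredT (in_factor J)) tcoef_prod_in_factor; last first.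
  by rewrite (map_inj_uniq rev_ord_inj) index_enum_uniq.
rewrite ifT; first by rewrite big_map [RHS](reindex_inj rev_ord_inj).
apply/forallP => k; rewrite implyNb; apply/orP; left; apply/mapP.
by exists (rev_ord k); rewrite ?mem_index_enum ?rev_ordK.
Qed.

Lemma prod_in_factor (A : pzRingType) (M : 'M[A]_n) d (u v : {ffun 'I_d -> 'I_n}) :
  tcoef (\big[mulmx/1%:M]_(k < d) in_factor M k) u v = \prod_k M (u k) (v k).
Proof.
rewrite tcoef_prod_in_factor ?index_enum_uniq // ifT //.
by apply/forallP => k; rewrite mem_index_enum.
Qed.

Variable Phi : {linear modof (FqM q n) -> modof (LqM q n)}.
Hypothesis Phi_spec : is_Phi Phi.

Lemma character_Phi_monomial m (i j : 'I_m -> 'I_n) : (0 < m)%N ->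
  chi (Phi (\prod_k Xmx q n (i k) (j k) : FqM q n)) = \prod_k J (i k) (j k).
Proof.
case: m i j => // d i j _; case: Phi_spec => _ /(_ d) PhiE.
have := character_prod_Lfactor [ffun k => i k] [ffun k => j k].
rewrite -PhiE.
rewrite tcoef_map (tcoef_map (Phi : FqM q n -> LqM q n)) prod_in_factor.
under eq_bigr => k _ do rewrite !ffunE.
by under [in RHS]eq_bigr => k _ do rewrite !ffunE.
Qed.

Variable ev : {algmorph FqM q n -> K^o}.
Hypothesis ev_J : forall i j, at_one (ev (Xmx q n i j)) = J i j.

Lemma character_Phi_scale (k : K) (x : FqM q n) :
  chi (Phi (algmap k * x : FqM q n)) = at_one k * chi (Phi x).
Proof.
have -> : Phi (algmap k * x : FqM q n) = (algmap k * (Phi x : LqM q n) : LqM q n).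
  exact: (linearZ_LR Phi k (x : modof (FqM q n))).
by rewrite rmorphM chi_scalar.
Qed.

Lemma at_one_ev_scale (k : K) (x : FqM q n) :
  at_one (ev (algmap k * x)) = at_one k * at_one (ev x).
Proof.
have -> : ev (algmap k * x) = k * ev x :> K.
  by rewrite rmorphM; congr (_ * _); exact: (algmorph (s := ev) k).
exact: (rmorphM (@at_one F)).
Qed.

Lemma character_Phi_qminor (I : {set 'I_n}) : (0 < #|I|)%N ->
  chi (Phi (qminor q I)) = at_one (ev (qminor q I)).
Proof.
move=> I0; rewrite /qminor.
rewrite (raddf_sum Phi) (raddf_sum chi) (raddf_sum ev) (raddf_sum (@at_one F)).
apply: eq_bigr => s _; apply: etrans (character_Phi_scale _ _) _.
apply: etrans _ (esym (at_one_ev_scale _ _)); rewrite character_Phi_monomial //.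
congr (_ * _); rewrite (rmorph_prod ev) (rmorph_prod (@at_one F)).
by apply: eq_bigr => k _; exact/esym/ev_J.
Qed.

(** At q = 1 the map Phi is multiplicative on the monomials of tau_d, so both
    sides evaluate the same polynomial at J. *)
Lemma character_Phi_tau d : (0 < d)%N -> chi (Phi (tau q n d)) = at_one (ev (tau q n d)).
Proof.
move=> d0; rewrite /tau.
rewrite (raddf_sum Phi) (raddf_sum chi) (raddf_sum ev) (raddf_sum (@at_one F)).
apply: eq_bigr => I /eqP Id; apply: etrans (character_Phi_scale _ _) _.
by apply: etrans _ (esym (at_one_ev_scale _ _)); rewrite character_Phi_qminor ?Id.
Qed.

End ClassicalPhi.

Local Open Scope classical_set_scope.

(** * Linear maps on tensor products of algebras *)

Section TensorMaps.
Variable K : comNzRingType.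

Lemma algmap_nat (A : pzAlgType K) m : algmap (m%:R : K) = m%:R :> A.
Proof. exact: rmorph_nat. Qed.

Lemma tens_lift0 (A B : pzAlgType K) (M : lmodType K) (f : A -> B -> M) :
  bilinear_map f -> tens_lift f 0 = 0.
Proof.
move=> fb; have := tens_lift_linear fb (-1) 0 0.
by rewrite scaler0 addr0 scaleN1r addNr.
Qed.

Lemma tens_lift_sum (A B : pzAlgType K) (M : lmodType K) (f : A -> B -> M)
    (I : Type) (r : seq I) (t : I -> tens A B) :
  bilinear_map f -> tens_lift f (\sum_(i <- r) t i) = \sum_(i <- r) tens_lift f (t i).
Proof.
move=> fb; apply: big_morph; last exact: tens_lift0.
by move=> s u; have := tens_lift_linear fb 1 s u; rewrite !scale1r.
Qed.

(** K-linearity for plain functions between K-algebras, which algebra morphisms and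
    linear maps between [modof] copies share. *)
Definition klinear (A B : pzAlgType K) (f : A -> B) : Prop :=
  (forall x y, f (x + y) = f x + f y)
  /\ (forall k x, f (algmap k * x) = algmap k * f x).

Lemma klinear_id (A : pzAlgType K) : klinear (@id A).
Proof. by []. Qed.

Lemma klinear_algmorph (A B : pzAlgType K) (f : {algmorph A -> B}) : klinear f.
Proof.
split=> [x y|k x]; first exact: rmorphD.
by rewrite rmorphM; congr (_ * _); exact: algmorph.
Qed.

Lemma klinear_modof (A B : pzAlgType K) (f : {linear modof A -> modof B}) :
  klinear (f : A -> B).
Proof.
split=> [x y|k x]; first exact: (raddfD f).
exact: (linearZ_LR f k (x : modof A)).
Qed.

Lemma bilinear_mul (A B C : pzAlgType K) (f : A -> C) (g : B -> C) :
  klinear f -> klinear g -> bilinear_map (M := modof C) (fun a b => f a * g b).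
Proof.
move=> [fD fZ] [gD gZ]; split=> [a a' b|a b b'|k a b|k a b].
- by rewrite fD mulrDl.
- by rewrite gD mulrDr.
- by rewrite fZ -mulrA.
- by rewrite gZ mulrA -algmapC -mulrA.
Qed.

Lemma bilinear_tens (A A' B B' : pzAlgType K) (f : A -> A') (g : B -> B') :
  klinear f -> klinear g -> bilinear_map (fun a b => f a ⊗ g b).
Proof.
move=> [fD fZ] [gD gZ]; split=> [a a' b|a b b'|k a b|k a b].
- by rewrite fD ptensDl.
- by rewrite gD ptensDr.
- by rewrite fZ ptensZl.
- by rewrite gZ ptensZr.
Qed.

Lemma tens_map_sum (A A' B B' : pzAlgType K) (f : A -> A') (g : B -> B')
    (I J : finType) (a : I -> J -> A) (b : I -> J -> B) :
  klinear f -> klinear g ->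
  tens_map f g (\sum_i \sum_j a i j ⊗ b i j) = \sum_i \sum_j f (a i j) ⊗ g (b i j).
Proof.
move=> fk gk; have fg := bilinear_tens fk gk.
rewrite /tens_map tens_lift_sum //; apply: eq_bigr => i _.
by rewrite tens_lift_sum //; apply: eq_bigr => j _; rewrite tens_liftE.
Qed.

End TensorMaps.

(** * Matrix polynomials *)

Section MatrixPolynomials.

(** Polynomials with coefficients placed on the left, because L has entries in a
    noncommutative algebra. *)
Definition mxeval (A : pzRingType) n d (c : nat -> A) (M : 'M[A]_n) : 'M[A]_n :=
  \sum_(i < d) (c i)%:M *m M ^+ i.

Lemma map_mxeval (A B : pzRingType) (g : {rmorphism A -> B}) n d c (M : 'M[A]_n) :
  map_mx g (mxeval d c M) = mxeval d (g \o c) (map_mx g M).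
Proof.
rewrite /mxeval raddf_sum; apply: eq_bigr => i _ /=.
rewrite map_mxM map_scalar_mx; congr (_ *m _).
elim: {i}(i : nat) => [|i IHi]; first by rewrite !expr0 map_mx1.
by rewrite !exprS -!mulmxE map_mxM IHi.
Qed.

Lemma central_scalar_mxC (A : pzRingType) n (c : A) (M : 'M[A]_n) :
  (forall x, c * x = x * c) -> c%:M *m M = M *m c%:M.
Proof.
move=> cC; rewrite mul_scalar_mx -diag_const_mx mul_mx_diag.
by apply/matrixP => i j; rewrite !mxE.
Qed.

Lemma mxeval_conj (A : pzRingType) n d (c : nat -> A) (S T M : 'M[A]_n) :
  S *m T = 1%:M -> T *m S = 1%:M -> (forall i x, c i * x = x * c i) ->
  mxeval d c (S *m M *m T) = S *m mxeval d c M *m T.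
Proof.
move=> ST TS cC; rewrite /mxeval mulmx_sumr mulmx_suml; apply: eq_bigr => i _.
rewrite mulmxA -(central_scalar_mxC _ (cC i)) -!mulmxA; congr (_ *m _).
elim: {i}(i : nat) => [|i IHi]; first by rewrite !expr0 mul1mx.
by rewrite !exprS -!mulmxE IHi !mulmxA -[_ *m T *m S]mulmxA TS mulmx1.
Qed.

End MatrixPolynomials.

Section LowDegreeEvaluation.
Variables (F : fieldType) (n : nat).

Lemma mxeval3 (M : 'M[F]_n) a b c :
  mxeval 3 (nth 0 [:: a; b; c]) M = a%:M + b *: M + c *: (M *m M).
Proof.
rewrite /mxeval !big_ord_recl big_ord0 addr0 /= !mul_scalar_mx expr0 expr1 expr2.
by rewrite addrA scalemx1.
Qed.

Lemma mxeval4 (M : 'M[F]_n) a b c d :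
  mxeval 4 (nth 0 [:: a; b; c; d]) M
  = a%:M + b *: M + c *: (M *m M) + d *: (M *m M *m M).
Proof.
rewrite /mxeval !big_ord_recl big_ord0 addr0 /= !mul_scalar_mx expr0 expr1 expr2.
by rewrite !addrA scalemx1 -mulmxA exprS expr2.
Qed.

End LowDegreeEvaluation.

(** * Embeddings produce points of the reflection equation *)

Section Hopf.
Variables (F : fieldType) (n : nat).
Local Notation K := (locK F).
Local Notation q := (locK_q F).
Local Notation H := (FqG q n).
Variables (HG : hopf H) (HG_qsl : is_qsl HG).
Local Notation T := (Tmx q n).

Definition antipode_mx : 'M[H]_n := \matrix_(i, j) (hanti HG (T i j) : H).
Local Notation S := antipode_mx.

Lemma antipode_mxE i j : S i j = hanti HG (T i j). Proof. by rewrite mxE. Qed.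

Lemma antipode_mulmx : S *m T = 1%:M.
Proof.
apply/matrixP => i j; have := hantil HG (T i j).
have bil : bilinear_map (M := modof H) (fun a b => (hanti HG a : H) * b).
  exact: (bilinear_mul (klinear_modof (hanti HG)) (klinear_id _)).
rewrite HG_qsl.1 HG_qsl.2 tens_lift_sum // => E.
rewrite mxE [RHS]mxE; transitivity (algmap ((i == j)%:R : K) : H); last first.
  exact: algmap_nat.
by rewrite -E; apply: eq_bigr => s _; rewrite tens_liftE // antipode_mxE.
Qed.

Lemma mulmx_antipode : T *m S = 1%:M.
Proof.
apply/matrixP => i j; have := hantir HG (T i j).
have bil : bilinear_map (M := modof H) (fun a b => a * (hanti HG b : H)).
  exact: (bilinear_mul (klinear_id _) (klinear_modof (hanti HG))).
rewrite HG_qsl.1 HG_qsl.2 tens_lift_sum // => E.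
rewrite mxE [RHS]mxE; transitivity (algmap ((i == j)%:R : K) : H); last first.
  exact: algmap_nat.
by rewrite -E; apply: eq_bigr => s _; rewrite tens_liftE // antipode_mxE.
Qed.

Variables (beta : comodalg HG (LqM q n)) (beta_adj : is_adjoint_coaction beta).
Variables (B : pzAlgType K) (phi : comodalg HG B) (p : {algmorph LqM q n -> B}).
Hypothesis phi_ind : forall f, phi (p f) = tens_map p id (beta f).
Variable theta : {algmorph B -> H}.
Hypothesis theta_coact : forall b, hdelta HG (theta b) = tens_map theta id (phi b).

(** The point of the quantum orbit that is the image of the unit element. *)
Definition base_character (x : LqM q n) : K := heps HG (theta (p x)).

(** Apply the counit to the first leg of Delta(theta(L)): since [theta] commutes
    with the coactions, this leg only sees the base point. *)
Lemma theta_Lmx : map_mx (theta \o p) (Lmx q n) =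
  S *m map_mx algmap (map_mx base_character (Lmx q n)) *m T.
Proof.
apply/matrixP => i j; rewrite mxE /=.
have bil : bilinear_map (M := modof H) (fun a b => algmap (heps HG a) * b).
  apply: (@bilinear_mul _ _ _ _ (fun a => algmap (heps HG a)) id _ (klinear_id _)).
  have [eD eZ] := klinear_algmorph (heps HG).
  by split=> [x y|k x]; rewrite ?eD ?eZ ?rmorphD ?rmorphM.
rewrite -[LHS](heps_counitl HG) theta_coact phi_ind beta_adj.
rewrite tens_map_sum; [|exact: klinear_algmorph|exact: klinear_id].
rewrite tens_map_sum; [|exact: klinear_algmorph|exact: klinear_id].
rewrite tens_lift_sum //; under eq_bigr => a _ do rewrite tens_lift_sum //.
rewrite exchange_big mxE; apply: eq_bigr => b _.
rewrite [X in _ = X * _]mxE mulr_suml; apply: eq_bigr => a _.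
rewrite (tens_liftE bil) antipode_mxE.
rewrite [X in _ = _ * X * _]mxE [X in _ = _ * algmap X * _]mxE.
by apply: etrans (mulrA _ _ _) _; congr (_ * _); exact: algmapC.
Qed.

Hypothesis theta_inj : injective theta.
Variable A : set H.
Hypothesis theta_range : range theta = A.
Hypothesis A_saturated : forall (k : K) h, k != 0 -> A (algmap k * h) -> A h.

(** theta(c(L)) = S(T) c(Y) T is a multiple (q - 1) h. As the image of [theta] is
    saturated, h = theta(b) for some b, and injectivity removes [theta]. *)
Lemma divisible_of_vanishing d (c : nat -> K) :
  map_mx (@at_one F) (mxeval d c (map_mx base_character (Lmx q n))) = 0 ->
  forall i j, exists b,
    mxeval d (fun m => algmap (c m)) (map_mx p (Lmx q n)) i j = algmap (q - 1) * b.
Proof.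
set Y := map_mx base_character _ => Y0.
have [Z YZ] : exists Z : 'M[K]_n, mxeval d c Y = (q - 1)%:M *m Z.
  have Zij i j : exists z, mxeval d c Y i j = (q - 1) * z.
    apply: at_one_eq0; have := congr1 (fun M : 'M[F]_n => M i j) Y0.
    by rewrite mxE [RHS]mxE.
  exists (\matrix_(i, j) sval (cid (Zij i j))).
  apply/matrixP => i j; rewrite mul_scalar_mx mxE mxE.
  by case: (cid (Zij i j)) => z /=.
move=> i j; set x := mxeval _ _ _ i j.
have thetax : theta x = algmap (q - 1) * (S *m map_mx algmap Z *m T) i j.
  have -> : theta x =
      map_mx theta (mxeval d (fun m => algmap (c m)) (map_mx p (Lmx q n))) i j.
    by rewrite [RHS]mxE.
  rewrite map_mxeval -map_mx_comp theta_Lmx.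
  rewrite (mxeval_conj _ _ antipode_mulmx mulmx_antipode); last first.
    by move=> m y /=; rewrite (algmorph (s := theta)) algmapC.
  have -> : mxeval d (theta \o (fun m => algmap (c m))) (map_mx algmap Y) =
      map_mx algmap (mxeval d c Y).
    rewrite (map_mxeval (@algmap K H)); apply: eq_bigr => m _ /=.
    by rewrite (algmorph (s := theta)).
  rewrite YZ map_mxM map_scalar_mx mulmxA.
  rewrite -(central_scalar_mxC S (algmapC (q - 1))) -!mulmxA mul_scalar_mx mxE.
  by [].
have Ax : A (algmap (q - 1) * (S *m map_mx algmap Z *m T) i j).
  by rewrite -thetax -theta_range; exists x.
have /A_saturated - /(_ (locK_q_neq1 F)) := Ax; rewrite -theta_range => -[b _ bE].
exists b; apply: theta_inj; rewrite thetax -bE.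
by have [_ ->] := klinear_algmorph theta.
Qed.

End Hopf.

Section Embedded.
Variables (F : fieldType) (n : nat).
Local Notation K := (locK F).
Local Notation q := (locK_q F).

Variables (HG : hopf (FqG q n)) (HG_qsl : is_qsl HG).
Variables (beta : comodalg HG (LqM q n)) (beta_adj : is_adjoint_coaction beta).
Variable Phi : {linear modof (FqM q n) -> modof (LqM q n)}.
Hypothesis Phi_spec : is_Phi Phi.
Variables (J : 'M[F]_n) (ev : {algmorph FqM q n -> K^o}).
Hypothesis ev_J : forall i j, ev (Xmx q n i j) = locK_const (J i j).
Variable phi : comodalg HG (FqO Phi ev).
Hypothesis phi_ind : forall f : LqM q n,
  phi (FqO_proj Phi ev f) = tens_map (FqO_proj Phi ev) id (beta f).

Local Notation p := (qproj (Ixi_gens Phi ev)).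

Lemma orbit_character : exists chi : {rmorphism FqO Phi ev -> F},
  (forall k : K, chi (algmap k) = at_one k)
  /\ map_mx (chi \o p) (Lmx q n) = J.
Proof.
have [chi [chiK chiL]] := classical_character J.
have evL i j : at_one (ev (Xmx q n i j)) = map_mx chi (Lmx q n) i j.
  by rewrite ev_J at_one_const chiL.
have gens x : Ixi_gens Phi ev x -> chi x = 0.
  move=> [d [/andP[d0 _] ->]]; rewrite rmorphB chiK.
  by rewrite (character_Phi_tau chiK Phi_spec evL d0) subrr.
have [chi' chi'E] := quotalg_lift gens.
exists chi'; split=> [k|]; first by rewrite -chiK -chi'E.
by rewrite -chiL; apply/matrixP => i j; rewrite [LHS]mxE [RHS]mxE -chi'E.
Qed.

(** Classically, an orbit map with injective pullback has its base point in the open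
    orbit. This is the algebraic trace of that fact: the base point, read at
    q = 1, satisfies no polynomial relation that J violates. *)
Lemma embedded_point : embedded phi -> exists Y : 'M[K]_n,
  RE_mx (Rhat_in q n (ord0 : 'I_2) ord_max) Y = 0
  /\ forall d c, mxeval d c (map_mx (@at_one F) Y) = 0 -> mxeval d c J = 0.
Proof.
move=> [A [_ [theta [theta_inj theta_range theta_coact]] A_sat]].
pose pm : {algmorph LqM q n -> FqO Phi ev} := p.
pose f : {rmorphism LqM q n -> K} :=
  (heps HG : {rmorphism FqG q n -> K}) \o theta \o pm.
have fK k : f (algmap k) = k.
  by rewrite /f /= !algmorph.
exists (map_mx f (Lmx q n)); split; first exact: RE_character.
move=> d c Y0.
have cE : (fun m => at_one (locK_const (c m))) = c.
  by apply: funext => m; exact: at_one_const.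
have [chi [chiK chiL]] := orbit_character.
have div := @divisible_of_vanishing _ _ _ HG_qsl _ beta_adj _ phi pm phi_ind
  theta theta_coact theta_inj A theta_range A_sat d (fun m => locK_const (c m)).
apply/matrixP => i j; have [|b] := div _ i j.
  by rewrite (map_mxeval (@at_one F)) -[RHS]Y0; congr (mxeval d _ _); exact: cE.
move=> /(congr1 chi); rewrite rmorphM chiK rmorphB rmorph1 /= at_one_q subrr mul0r.
rewrite mxE => <-.
have -> : chi (mxeval d (fun m => algmap (locK_const (c m))) (map_mx pm (Lmx q n)) i j)
  = map_mx chi (mxeval d (fun m => algmap (locK_const (c m))) (map_mx pm (Lmx q n))) i j.
  by rewrite [RHS]mxE.
rewrite map_mxeval -map_mx_comp chiL.
by congr (mxeval d _ J i j); apply: funext => m /=; rewrite chiK at_one_const.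
Qed.

End Embedded.

Lemma embedded_relation (F : fieldType) (n : nat) (J : 'M[F]_n) (Y : 'M[locK F]_n) :
  2 != 0 :> F -> (0 < n)%N ->
  RE_mx (Rhat_in (locK_q F) n (ord0 : 'I_2) ord_max) Y = 0 ->
  (forall d c, mxeval d c (map_mx (@at_one F) Y) = 0 -> mxeval d c J = 0) ->
  exists l c, low_degree_relation J l c.
Proof.
case: n J Y => // n J Y two _ /RE_first_order/(poisson_zero_relation two) /=.
move=> [l [c rel]] transfer; exists l, c.
case: rel => [sq|[c0 cube]]; [left|right; split=> //].
  have /transfer : mxeval 3 (nth 0 [:: 0; - l; 1]) (map_mx (@at_one F) Y) = 0.
    by rewrite mxeval3 sq scale1r scaleNr raddf0 add0r addNr.
  by rewrite mxeval3 raddf0 add0r scale1r scaleNr addrC => /eqP; rewrite subr_eq0 => /eqP.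
have /transfer : mxeval 4 (nth 0 [:: 0; - c; - l; 1]) (map_mx (@at_one F) Y) = 0.
  by rewrite mxeval4 cube scale1r !scaleNr raddf0 add0r -opprD [X in - X]addrC addNr.
rewrite mxeval4 raddf0 add0r scale1r !scaleNr -opprD addrC => /eqP.
by rewrite subr_eq0 [c *: J + _]addrC => /eqP.
Qed.

Unset Implicit Arguments.

Theorem proposition4p2 (R : realType) (n : nat) (n_gt0 : (0 < n)%N)
  (HG : hopf (FqG (locK_q R[i]) n)) (HG_qsl : is_qsl HG)
  (beta : comodalg HG (LqM (locK_q R[i]) n)) (beta_adj : is_adjoint_coaction beta)
  (Phi : {linear modof (FqM (locK_q R[i]) n) -> modof (LqM (locK_q R[i]) n)})
  (Phi_spec : is_Phi Phi)
  (xi : 'M[R[i]]_n) (xi_P : P_set xi)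
  (r : nat) (lam : seq R[i]) (xi_J : jordan_form xi r lam)
  (ev : {algmorph FqM (locK_q R[i]) n -> (locK R[i])^o})
  (ev_J : forall i j,
     ev (Xmx (locK_q R[i]) n i j) = locK_const (jordan_mx n r lam i j))
  (phi : comodalg HG (FqO Phi ev))
  (phi_ind : forall f : LqM (locK_q R[i]) n,
     phi (FqO_proj Phi ev f) = tens_map (FqO_proj Phi ev) id (beta f))
  (cases : (3 <= r)%N \/ ((3 <= n)%N /\ r = 2%N) \/
     (exists s : seq R[i], [/\ size s = 3%N, uniq s
        & forall a, a \in s -> a != 0 /\ eigenvalue xi a])) :
  ~ embedded phi.
Proof.
move=> /(embedded_point HG_qsl beta_adj Phi_spec ev_J phi_ind)[Y [RE0 transfer]].
have two : 2 != 0 :> R[i] by rewrite Num.Theory.pnatr_eq0.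
have [l [c rel]] := embedded_relation two n_gt0 RE0 transfer.
case: xi_J => rn szl _ lam0 [g [g1 JE]].
have block : (1 < r)%N -> (2 < n)%N -> False.
  by move=> r1 n2; exact: jordan_block_obstruction szl lam0 rn r1 n2 rel.
case: cases => [r3|[[n3 r2]|[s [szs us sE]]]].
- by apply: block; [exact: ltnW|exact: leq_trans rn].
- by apply: block; rewrite ?r2.
apply: (three_eigenvalues_obstruction szs us _ rel) => a /sE[a0 /eigenvalueP[v va v0]].
split=> //; apply/eigenvalueP; exists (v *m g).
  have gU : g \in unitmx by rewrite unitmxE g1 unitr1.
  by rewrite JE !mulmxA mulmxK // va scalemxAl.
apply: contra_neq v0 => vg; have gU : g \in unitmx by rewrite unitmxE g1 unitr1.
by rewrite -(mulmxK gU v) vg mul0mx.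
Qed.
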